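(* Let $\alpha,\beta,\gamma>0$, let $n\ge 2$ be an integer, let $X_n=\xi^n$ and $Y_n=\xi_1\cdots\xi_n$, where $\xi_1,\ldots,\xi_n$ are independent copies of $\xi\sim GG(\alpha,\beta,\gamma)$. Then $X_n$ is M-det if and only if $Y_n$ is M-det, and this is true if and only if $n\le 2\beta$. In other words, both $X_n$ and $Y_n$ have the same moment determinacy property.
   Context: For $\alpha,\beta,\gamma>0$, $\xi\sim GG(\alpha,\beta,\gamma)$ (generalized gamma distribution) means that $\xi$ is a nonnegative random variable with density $f(x)=c\,x^{\gamma-1}e^{-\alpha x^{\beta}}$, $x\ge 0$ (with $f(0)=0$ if $\gamma\ne 1$), where $c=\beta\alpha^{\gamma/\beta}/\Gamma(\gamma/\beta)$. A nonnegative random variable with all moments finite is called M-det (moment determinate, in the sense of the Stieltjes moment problem) if its distribution is the only probability distribution on $[0,\infty)$ having its moment sequence; otherwise it is called M-indet. *)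

(* Defs.v *)
From HB Require Import structures.
From mathcomp Require Import all_boot all_order all_algebra.
From mathcomp Require Import all_classical all_reals all_analysis.

Set Implicit Arguments.
Unset Strict Implicit.
Unset Printing Implicit Defensive.

Import Order.TTheory GRing.Theory Num.Theory.
Import numFieldNormedType.Exports.

Local Open Scope classical_set_scope.
Local Open Scope ring_scope.

(* Euler's Gamma function, used only at s > 0, where the integral converges. *)
Definition Gamma {R : realType} (s : R) : R :=
  \int[lebesgue_measure]_(x in `]0, +oo[) (x `^ (s - 1) * expR (- x)).

(* Since 0 `^ 0 = 1 and 0 `^ y = 0 for y != 0, the value at 0 is 0 exactly when
   gamma != 1. *)
Definition gg_pdf {R : realType} (alpha beta gamma : R) : R -> R :=
  (fun x => beta * alpha `^ (gamma / beta) / Gamma (gamma / beta)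
              * x `^ (gamma - 1) * expR (- (alpha * x `^ beta)))
    \_ `[0, +oo[.

(* The density vanishes on the negative half-line, so X >= 0 almost surely. *)
Definition is_GG {R : realType} {d : measure_display} {T : measurableType d}
    (P : probability T R) (alpha beta gamma : R) (X : {RV P >-> R}) : Prop :=
  forall A : set R, measurable A ->
    distribution P X A =
      (\int[lebesgue_measure]_(x in A) (gg_pdf alpha beta gamma x)%:E)%E.

Definition mutually_independent {R : realType} {d : measure_display}
    {T : measurableType d} (P : probability T R) (I : finType)
    (X : I -> {RV P >-> R}) : Prop :=
  forall (J : {set I}) (A : I -> set R), (forall i, measurable (A i)) ->
    P (\bigcap_(i in [set` J]) (X i @^-1` A i)) =
      (\prod_(i in J) P (X i @^-1` A i))%E.

Definition moment {R : realType} (mu : probability R R) (k : nat) : \bar R :=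
  (\int[mu]_x (x ^+ k)%:E)%E.

Definition supported_nonneg {R : realType} (mu : probability R R) : Prop :=
  mu `[0, +oo[%classic = 1%E.

Definition finite_moments {R : realType} (mu : probability R R) : Prop :=
  forall k : nat, mu.-integrable [set: R] (fun x : R => (x ^+ k)%:E).

(* The variables for which the Stieltjes moment problem is posed. Nonnegativity
   is almost sure, being a property of the law. *)
Definition stieltjes_admissible {R : realType} {d : measure_display}
    {T : measurableType d} (P : probability T R) (X : {RV P >-> R}) : Prop :=
  supported_nonneg (distribution P X) /\ finite_moments (distribution P X).

Definition M_det {R : realType} {d : measure_display} {T : measurableType d}
    (P : probability T R) (X : {RV P >-> R}) : Prop :=
  stieltjes_admissible X /\
  forall nu : probability R R, supported_nonneg nu ->
    (forall k : nat, moment nu k = moment (distribution P X) k) ->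
    forall A : set R, measurable A -> nu A = distribution P X A.

(* Main.v *)
Require Import Defs.
From HB Require Import structures.
From mathcomp Require Import all_boot all_order all_algebra.
From mathcomp Require Import all_classical all_reals all_analysis.
From mathcomp Require Import complex measurable_realfun ring lra zify.

Set Implicit Arguments.
Unset Strict Implicit.
Unset Printing Implicit Defensive.

Import Order.TTheory GRing.Theory Num.Theory.
Import numFieldNormedType.Exports.

Local Open Scope classical_set_scope.
Local Open Scope ring_scope.

(** Determinacy when [n <= 2 * beta]. Since [x ^ (n / 2) <= 1 + x ^ beta] and
    [exp (de * xi ^ beta)] is integrable for [de < alpha], the moment of order
    [j] of [xi ^ n] is at most [C * b ^ (2 * j) * (2 * j)!] ([GG_moment_le]).
    The same holds for the product of the [xi_i], because a product of [n]
    nonnegative reals is at most the sum of their [n]-th powers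
    ([prod_le_sum_expn]). A law with such a bound is determined by its moments
    ([hardy_determinacy]): for a variable [X] with that law and [W = sqrt X],
    the even moments of [W] are the moments of [X], so they fix all the
    derivatives at [0] of [t |-> E cos (t * W)], and the bound says that the
    Taylor series of this function, at any point, has a radius of convergence
    at least [1 / b]. Equality with the transform of another law with these
    moments therefore propagates from [0] to the whole line by steps of fixed
    length ([cos_transform_eq]). The cosine transform determines the law on
    the half-line, because polynomials in [cos (th * w)] approximate the
    indicator of [w < a] ([cos_transform_inj]).

    Indeterminacy when [2 * beta < n]. Let [psi = pi * beta / n], which is
    less than [pi / 2]. Rotating the ray of integration in the Gamma integral
    by the angle that changes [alpha] into [alpha * (1 - 'i * tan psi)] only
    multiplies the integral by a constant and a phase ([rotation_integral]),
    hence for real [r >= 0] and any [phi]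
[[
E [xi ^ r * cos (alpha * tan psi * xi ^ beta + phi)]
  = C_r * cos ((gamma + r) * psi / beta + phi),   C_r > 0
]]
    ([GG_trig]), where [psi / beta = pi / n]. Raising [xi] to the power [n]
    turns the phase into [pi * r] up to a constant; so does multiplying [n]
    independent copies, each contributing [pi * r / n] ([GG_prod_trig], from
    [independent_Rintegral_prod]). Both for [U = X] and for [U = Y], a
    suitable constant phase thus yields a cosine [g] with
    [E [U ^ r * g] = c_r * cos (pi * r - pi / 2)] and [c_r > 0].
    This vanishes when [r] is a natural number but not when [r] is one half. The law of [U] under the
    density [1 + g] therefore has the moments of [U] but another expectation
    of the square root ([rotated_not_M_det]). *)

(** * Integration against a density *)

Section density.
Context d (T : measurableType d) (R : realType) (mu : {measure set T -> \bar R}).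
Variables (g : T -> R) (mg : measurable_fun setT g) (g0 : forall x, 0 <= g x).

(** The hypotheses on [g] are arguments so that the measure structure below can
    be inferred from the term. *)
Definition density_measure (_ : measurable_fun setT g) (_ : forall x, 0 <= g x)
    (A : set T) : \bar R := (\int[mu]_(x in A) (g x)%:E)%E.

Local Notation nu := (density_measure mg g0).

Let density0 : nu set0 = 0%E.
Proof. exact: integral_set0. Qed.

Let density_ge0 A : (0 <= nu A)%E.
Proof. by apply: integral_ge0 => x _; rewrite lee_fin. Qed.

Let density_sigma_additive : semi_sigma_additive nu.
Proof.
apply: semi_sigma_additive_nng_induced; first exact/measurable_EFinP.
by move=> x; rewrite lee_fin.
Qed.

HB.instance Definition _ := isMeasure.Build _ _ _ nu
  density0 density_ge0 density_sigma_additive.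

End density.

Section ge0_integral_density.
Context d (T : measurableType d) (R : realType) (mu nu : {measure set T -> \bar R}).
Local Open Scope ereal_scope.
Import HBNNSimple.

(** Both sides are continuous along increasing sequences, so simple functions
    suffice, and by linearity indicators.  The measure [nu] is only assumed to
    agree with the density on sets, hence applies to laws given in that way. *)
Lemma ge0_integral_density (g : T -> R) (f : T -> \bar R) :
  measurable_fun setT g -> (forall x, (0 <= g x)%R) ->
  (forall A, measurable A -> nu A = \int[mu]_(x in A) (g x)%:E) ->
  measurable_fun setT f -> (forall x, 0 <= f x) ->
  \int[nu]_x f x = \int[mu]_x (f x * (g x)%:E).
Proof.
move=> /measurable_EFinP mg g0 nuE mf f0.
pose h := nnsfun_approx measurableT mf.
have hf x : EFin (h n x) @[n --> \oo] --> f x.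
  exact: (@cvg_nnsfun_approx _ _ _ _ measurableT _ mf (fun x _ => f0 x)).
have hnd n m x : (n <= m)%N -> (h n x <= h m x)%R.
  by move=> nm; exact/lefP/nd_nnsfun_approx.
have mh n : measurable_fun [set: T] (EFin \o h n).
  exact/measurable_EFinP/measurable_funP.
transitivity (limn (fun n => \int[nu]_x (h n x)%:E)).
  rewrite -monotone_convergence//.
  - by apply: eq_integral => x _; apply/esym/cvg_lim => //; exact: hf.
  - by move=> n x _; rewrite lee_fin.
  - by move=> x _ n m nm; rewrite lee_fin hnd.
transitivity (limn (fun n => \int[mu]_x ((h n x)%:E * (g x)%:E))); last first.
  rewrite -monotone_convergence//.
  - apply: eq_integral => x _; apply/cvg_lim => //.
    exact/cvgeZr/hf.
  - by move=> n; exact: emeasurable_funM (mh n) mg.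
  - by move=> n x _; rewrite mule_ge0 ?lee_fin.
  - by move=> x _ n m nm; rewrite lee_wpmul2r ?lee_fin ?hnd.
congr (limn _); apply/funext => n.
transitivity (\sum_(y \in range (h n)) \int[nu]_x (y * \1_(h n @^-1` [set y]) x)%:E).
  under eq_integral do rewrite fimfunE -fsumEFin//.
  rewrite ge0_integral_fsum//.
  - by move=> y; apply/measurable_EFinP/measurable_funM.
  - by move=> y x _; rewrite EFinM nnfun_muleindic_ge0.
transitivity (\sum_(y \in range (h n))
   \int[mu]_x ((y * \1_(h n @^-1` [set y]) x)%:E * (g x)%:E)); last first.
  rewrite -ge0_integral_fsum//.
  - apply: eq_integral => x _.
    rewrite fimfunE -fsumEFin// ge0_mule_fsuml// => y.
    by rewrite EFinM nnfun_muleindic_ge0.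
  - move=> y; apply: (emeasurable_funM _ mg).
    by apply/measurable_EFinP/measurable_funM.
  - by move=> y x _; rewrite EFinM mule_ge0 ?nnfun_muleindic_ge0// lee_fin.
apply: eq_fsbigr => y; rewrite inE => -[t _ <-{y}].
set y := h n t; have y0 : (0 <= y)%R by [].
rewrite integralZl_indic_nnsfun// integral_indic// setIT nuE//.
under [RHS]eq_integral do rewrite EFinM -muleA.
rewrite ge0_integralZl//; last 2 first.
- by apply: (emeasurable_funM _ mg); apply/measurable_EFinP.
- by move=> x _; rewrite mule_ge0// lee_fin.
congr (_ * _); rewrite integral_mkcond; apply: eq_integral => x _.
by rewrite epatch_indic muleC.
Qed.

End ge0_integral_density.

Lemma measurable_cosT d (T : measurableType d) (R : realType) (f : T -> R) :
  measurable_fun setT f -> measurable_fun setT (fun x => cos (f x)).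
Proof.
move=> mf; apply: (measurableT_comp _ mf).
apply: continuous_measurable_fun; exact: continuous_cos.
Qed.

Lemma dominated_cvg_Rintegral d (T : measurableType d) (R : realType)
    (mu : {measure set T -> \bar R}) (D : set T) (f_ : nat -> T -> R) (f g : T -> R) :
  measurable D -> (forall n, measurable_fun D (f_ n)) ->
  (forall x, D x -> f_ n x @[n --> \oo] --> f x) ->
  mu.-integrable D (EFin \o g) ->
  (forall n x, D x -> `|f_ n x| <= g x) ->
  mu.-integrable D (EFin \o f) /\
  \int[mu]_(x in D) f_ n x @[n --> \oo] --> \int[mu]_(x in D) f x.
Proof.
move=> mD mf_ cf ig fg.
have mf : measurable_fun D f by exact: measurable_fun_cvg cf.
have cf' : {ae mu, forall x, D x -> (f_ n x)%:E @[n --> \oo] --> (f x)%:E}.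
  by apply: aeW => x Dx; apply: cvg_EFin; [exact: nearW|exact: cf].
have fg' : {ae mu, forall x n, D x -> (`|(f_ n x)%:E| <= (g x)%:E)%E}.
  by apply: aeW => x n Dx; rewrite lee_fin fg.
have [intf _ cvf] := dominated_convergence mD
  (fun n => (measurable_EFinP _ _).2 (mf_ n)) ((measurable_EFinP _ _).2 mf)
  cf' ig fg'.
split => //; apply: fine_cvg; rewrite fineK//; exact: integrable_fin_num.
Qed.

Lemma bounded_prob_integrable d (T : measurableType d) (R : realType)
    (mu : probability T R) (f : T -> R) (M : R) :
  measurable_fun setT f -> (forall x, `|f x| <= M) ->
  mu.-integrable setT (EFin \o f).
Proof.
move=> mf fM.
apply: (le_integrable measurableT _ _ (finite_measure_integrable_cst mu M measurableT)).
  exact/measurable_EFinP.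
by move=> x _ /=; rewrite lee_fin (le_trans (fM x))// ler_norm.
Qed.

(** * Products of functions of independent variables *)

Section independence.
Context d (T : measurableType d) (R : realType) (P : probability T R).
Context (I : finType) (X : I -> {RV P >-> R}).
Hypothesis indepX : mutually_independent X.

Let upd (f : I -> R -> R) k g := fun i => if i == k then g else f i.

Let measurable_coord_prod (f : I -> R -> R) (p : pred I) :
  (forall i, measurable_fun setT (f i)) ->
  measurable_fun setT (fun t => \prod_(i | p i) f i (X i t)).
Proof.
move=> mf; under eq_fun do rewrite big_mkcond.
apply: measurable_prod => i _; case: (p i) => //.
exact: (measurableT_comp (mf i)).
Qed.

Let prod_upd (f : I -> R -> R) k g t :
  \prod_i upd f k g i (X i t) = g (X k t) * \prod_(i | i != k) f i (X i t).
Proof.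
rewrite (bigD1 k)//= {1}/upd eqxx; congr *%R.
by apply: eq_bigr => i /negPf ik; rewrite /upd ik.
Qed.

Let integral_indicT (A : set T) : measurable A ->
  (\int[P]_t (\1_A t)%:E = P A)%E.
Proof. by move=> mA; rewrite integral_indic// setIT. Qed.

Let mX i (A : set R) : measurable A -> measurable (X i @^-1` A).
Proof. by move=> mA; rewrite -[X in measurable X]setTI; exact: measurable_funP. Qed.

Let indep_indic (A : I -> set R) : (forall i, measurable (A i)) ->
  (\int[P]_t (\prod_i \1_(A i) (X i t))%:E =
   \prod_i \int[P]_t (\1_(A i) (X i t))%:E)%E.
Proof.
move=> mA; have := indepX [set: I]%SET mA.
have -> : \bigcap_(i in [set` [set: I]%SET]) (X i @^-1` A i) =
          [set t | forall i, A i (X i t)].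
  by apply/seteqP; split => t /= h i; [apply: h => /=; rewrite inE|move=> _; exact: h].
have mall : measurable [set t | forall i, A i (X i t)].
  rewrite (_ : mkset _ = \bigcap_(i in [set: I]) (X i @^-1` A i)).
    by apply: fin_bigcap_measurable => // i _; exact: mX.
  by apply/seteqP; split => t /= h i; [move=> _; exact: h|exact: h].
move=> PE; transitivity (P [set t | forall i, A i (X i t)]).
  rewrite -integral_indicT//; apply: eq_integral => t _.
  congr EFin; have [h|] := pselect (forall i, A i (X i t)).
    rewrite big1 => [|i _]; last by rewrite indicE mem_set.
    by rewrite indicE mem_set.
  move=> h; rewrite [in RHS]indicE memNset//.
  have [i hi] := (existsNP _).2 h.
  by rewrite (bigD1 i)//= indicE memNset// mul0r.
rewrite PE; apply: eq_big => [i|i _]; first by rewrite inE.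
by rewrite -integral_indicT//; exact: mX.
Qed.

(** Only the coordinates in [K] are not yet indicators.  For [k] in [K], the
    induction hypothesis with an indicator in place of [f k] says that, under
    the density formed by the other factors, the law of [X k] is its law under
    [P] up to the constant [c]; hence [f k] can be integrated against either. *)
Let ge0_indep_in (K : {set I}) (f : I -> R -> R) :
  (forall i, measurable_fun setT (f i)) -> (forall i x, 0 <= f i x) ->
  (forall i, \int[P]_t (f i (X i t))%:E < +oo)%E ->
  (forall i, i \notin K -> exists2 A, measurable A & f i = \1_A) ->
  (\int[P]_t (\prod_i f i (X i t))%:E = \prod_i \int[P]_t (f i (X i t))%:E)%E.
Proof.
have [m] := ubnP #|K|; elim: m K f => // m IH K f; rewrite ltnS => Km mf f0 foo fK.
have [K0|[k kK]] := set_0Vmem K.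
  have /choice[A hA] : forall i, exists A, measurable A /\ f i = \1_A.
    by move=> i; have [|A] := fK i; [rewrite K0 inE|exists A].
  under eq_integral do under eq_bigr do rewrite (hA _).2.
  under eq_bigr do under eq_integral do rewrite (hA _).2.
  by apply: indep_indic => i; exact: (hA i).1.
pose g t := \prod_(i | i != k) f i (X i t).
have mg : measurable_fun setT g by exact: measurable_coord_prod.
have g0 t : 0 <= g t by exact: prodr_ge0.
pose c := (\prod_(i | i != k) \int[P]_t (f i (X i t))%:E)%E.
have c0 : (0 <= c)%E.
  by apply: prode_ge0 => i _; apply: integral_ge0 => t _; rewrite lee_fin.
have cfin : c \is a fin_num.
  apply: prode_fin_num => i _; rewrite ge0_fin_numE//.
  by apply: integral_ge0 => t _; rewrite lee_fin.
have gA (A : set R) : measurable A ->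
    (\int[P]_t (\1_A (X k t) * g t)%:E = c * distribution P (X k) A)%E.
  move=> mA; have := IH (K :\ k)%SET (upd f k \1_A).
  under eq_integral do rewrite prod_upd.
  move=> ->.
  - rewrite (bigD1 k)//= muleC /upd eqxx; congr (_ * _)%E.
      by apply: eq_bigr => i /negPf ->.
    rewrite (_ : (fun t => _) = EFin \o \1_(X k @^-1` A)) ?integral_indicT//.
    exact: mX.
  - by rewrite (leq_trans _ Km)// (cardsD1 k K) kK.
  - by move=> i; rewrite /upd; case: ifP.
  - by move=> i x; rewrite /upd; case: ifP.
  - move=> i; rewrite /upd; case: ifP => // _.
    rewrite (_ : (fun t => _) = EFin \o \1_(X i @^-1` A))//.
    by rewrite integral_indicT ?ltey_eq ?fin_num_measure//; exact: mX.
  - move=> i; rewrite !inE negb_and negbK /upd; case: eqP => [->|_ /=].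
      by exists A.
    exact: fK.
rewrite (bigD1 k)//= -/c.
under eq_integral do rewrite (bigD1 k)//= -/(g _) EFinM.
pose m1 := pushforward (density_measure P mg g0) (X k).
pose cn : {nonneg R} := NngNum (fine_ge0 c0).
transitivity (\int[m1]_x (f k x)%:E)%E.
  rewrite ge0_integral_pushforward//; last 2 first.
    exact/measurable_EFinP.
    by move=> x _; rewrite lee_fin.
  rewrite preimage_setT [RHS](@ge0_integral_density _ _ _ P _ g)//.
  - by apply/measurable_EFinP; exact: (measurableT_comp (mf k)).
  - by move=> t; rewrite lee_fin.
transitivity (\int[mscale cn (distribution P (X k))]_x (f k x)%:E)%E.
  apply: eq_measure_integral => A mA _.
  rewrite /m1 /pushforward/= /density_measure /mscale /= fineK// -gA//.
  rewrite [LHS]integral_mkcond; apply: eq_integral => t _.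
  by rewrite epatch_indic EFinM muleC.
rewrite ge0_integral_mscale//; last 2 first.
  exact/measurable_EFinP.
  by move=> x _; rewrite lee_fin.
rewrite /= fineK// muleC ge0_integral_distribution//.
  exact/measurable_EFinP.
by move=> x; rewrite lee_fin.
Qed.

(** Independence is a statement on indicators; [ge0_indep_in] extends it to
    nonnegative functions, and splitting each factor into its positive and
    negative parts, one coordinate at a time, to integrable ones. *)
Lemma independent_Rintegral_prod (f : I -> R -> R) :
  (forall i, measurable_fun setT (f i)) ->
  (forall i, P.-integrable setT (fun t => (f i (X i t))%:E)) ->
  P.-integrable setT (fun t => (\prod_i f i (X i t))%:E) /\
  \int[P]_t (\prod_i f i (X i t)) = \prod_i \int[P]_t f i (X i t).
Proof.
suff H (K : {set I}) : forall f : I -> R -> R,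
    (forall i, measurable_fun setT (f i)) ->
    (forall i, P.-integrable setT (fun t => (f i (X i t))%:E)) ->
    (forall i, i \notin K -> forall x, 0 <= f i x) ->
    P.-integrable setT (fun t => (\prod_i f i (X i t))%:E) /\
    \int[P]_t (\prod_i f i (X i t)) = \prod_i \int[P]_t f i (X i t).
  by move=> mf fi; apply: (H [set: I]%SET) => // i; rewrite inE.
have [m] := ubnP #|K|; elim: m K => // m IH K; rewrite ltnS => Km {}f mf fi f0.
have [K0|[k kK]] := set_0Vmem K.
  have {}f0 i x : 0 <= f i x by apply: f0; rewrite K0 inE.
  have {}E : (\int[P]_t (\prod_i f i (X i t))%:E =
             \prod_i \int[P]_t (f i (X i t))%:E)%E.
    apply: (ge0_indep_in (K := [set: I]%SET)) => // i; last by rewrite inE.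
    have /integrableP[_] := fi i.
    by under eq_integral do rewrite gee0_abs ?lee_fin//.
  have fin i : (\int[P]_t (f i (X i t))%:E)%E \is a fin_num.
    exact: integrable_fin_num.
  have {}E : (\int[P]_t (\prod_i f i (X i t))%:E =
             (\prod_i \int[P]_t f i (X i t))%:E)%E.
    by rewrite E -prodEFin; apply: eq_bigr => i _; rewrite fineK.
  split; last by rewrite [LHS]/Rintegral E.
  apply/integrableP; split; first exact/measurable_EFinP/measurable_coord_prod.
  under eq_integral do rewrite gee0_abs ?lee_fin ?prodr_ge0//.
  by rewrite E ltry.
pose fp x : R := Num.max (f k x) 0; pose fn x : R := Num.max (- f k x) 0.
have fpn x : f k x = fp x - fn x.
  rewrite /fp /fn; have [h|h] := leP 0 (f k x).
    by rewrite (max_idPr _) ?subr0// oppr_le0.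
  by rewrite (max_idPl _) ?sub0r ?opprK// oppr_ge0 ltW.
have IHk (h : R -> R) : measurable_fun setT h -> (forall x, `|h x| <= `|f k x|) ->
    (forall x, 0 <= h x) ->
    P.-integrable setT (fun t => (h (X k t))%:E) /\
    P.-integrable setT (fun t => (\prod_i upd f k h i (X i t))%:E) /\
    \int[P]_t (\prod_i upd f k h i (X i t)) =
    \prod_i \int[P]_t upd f k h i (X i t).
  move=> mh hf h0.
  have ih : P.-integrable setT (fun t => (h (X k t))%:E).
    apply: (le_integrable measurableT _ _ (fi k)).
      by apply/measurable_EFinP; exact: (measurableT_comp mh).
    by move=> t _ /=; rewrite lee_fin.
  split => //; apply: (IH (K :\ k)%SET).
  - by rewrite (leq_trans _ Km)// (cardsD1 k K) kK.
  - by move=> i; rewrite /upd; case: ifP.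
  - by move=> i; rewrite /upd; case: eqP => // ->.
  - move=> i; rewrite !inE negb_and negbK /upd; case: eqP => [//|_ /= iK].
    exact: f0.
have [ip [jp Ep]] : P.-integrable setT (fun t => (fp (X k t))%:E) /\
    P.-integrable setT (fun t => (\prod_i upd f k fp i (X i t))%:E) /\
    \int[P]_t (\prod_i upd f k fp i (X i t)) =
    \prod_i \int[P]_t upd f k fp i (X i t).
  apply: IHk => [|x|x].
  - exact: measurable_maxr.
  - by rewrite /fp; case: (leP 0 (f k x)) => h //=; rewrite normr0.
  - by rewrite /fp le_max lexx orbT.
have [im [jm Em]] : P.-integrable setT (fun t => (fn (X k t))%:E) /\
    P.-integrable setT (fun t => (\prod_i upd f k fn i (X i t))%:E) /\
    \int[P]_t (\prod_i upd f k fn i (X i t)) =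
    \prod_i \int[P]_t upd f k fn i (X i t).
  apply: IHk => [|x|x].
  - by apply: measurable_maxr => //; exact: measurableT_comp.
  - by rewrite /fn; case: (leP 0 (- f k x)) => h //=; rewrite ?normr0 ?normrN.
  - by rewrite /fn le_max lexx orbT.
have prodE t : \prod_i f i (X i t) =
    \prod_i upd f k fp i (X i t) - \prod_i upd f k fn i (X i t).
  by rewrite !prod_upd (bigD1 k)//= fpn mulrBl.
have updE h : \prod_i \int[P]_t upd f k h i (X i t) =
    \int[P]_t h (X k t) * \prod_(i | i != k) \int[P]_t f i (X i t).
  rewrite (bigD1 k)//= {1}/upd eqxx; congr *%R.
  by apply: eq_bigr => i /negPf ik; rewrite /upd ik.
split.
  under eq_fun do rewrite prodE EFinB.
  exact: integrableB.
under eq_Rintegral do rewrite prodE.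
rewrite RintegralB// Ep Em !updE -mulrBl [RHS](bigD1 k)//=; congr *%R.
by under [RHS]eq_Rintegral do rewrite fpn; rewrite RintegralB.
Qed.

End independence.

(** * Taylor bounds for the cosine transform *)

Lemma is_derive_ge0_le (R : realType) (f df : R -> R) (a x : R) :
  (forall y : R, is_derive y 1 f (df y)) -> (forall y, a <= y -> 0 <= df y) ->
  a <= x -> f a <= f x.
Proof.
move=> fd df0 ax.
have cf : continuous f.
  move=> y; apply/differentiable_continuous/derivable1_diffP.
  exact: (@ex_derive _ _ _ _ _ _ _ (fd y)).
apply: (@ger0_derive1_ndecry _ f a _ _ _ a x (lexx a) ax) => [y _|y|].
- exact: (@ex_derive _ _ _ _ _ _ _ (fd y)).
- rewrite in_itv/= andbT => ay.
  by rewrite derive1E (@derive_val _ _ _ _ _ _ _ (fd y)) df0// ltW.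
- exact: continuous_subspaceT.
Qed.

Section cos_taylor.
Variable R : realType.
Implicit Types (t u : R) (N : nat).

(** The derivative of order [i] of the cosine is [cos (. + i * pi / 2)]. *)
Definition cos_taylor N t : {poly R} :=
  \poly_(i < N) (cos (t + i%:R * (pi / 2)) / i`!%:R).

Lemma deriv_cos_taylor N t :
  (cos_taylor N.+1 t)^`() = cos_taylor N (t + pi / 2).
Proof.
apply/polyP => i; rewrite coef_deriv !coef_poly ltnS.
case: ifP => _; last by rewrite mul0rn.
rewrite -[_ *+ i.+1]mulr_natr factS natrM.
rewrite (_ : t + i.+1%:R * (pi / 2) = t + pi / 2 + i%:R * (pi / 2)); last first.
  by rewrite -natr1; ring.
by field; rewrite pnatr_eq0 -lt0n fact_gt0 addrC natr1 pnatr_eq0.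
Qed.

Lemma is_derive_horner (p : {poly R}) (x : R) : is_derive x 1 (horner p) p^`().[x].
Proof.
apply: DeriveDef; first exact: derivable_horner.
by rewrite -derive1E derivE.
Qed.

Lemma is_derive_expn_fact N (x : R) :
  is_derive x 1 (fun y => y ^+ N.+1 / N.+1`!%:R) (x ^+ N / N`!%:R).
Proof.
rewrite (_ : (fun y => _) = horner ((N.+1`!%:R)^-1 *: ('X ^+ N.+1))); last first.
  by apply/funext => y; rewrite hornerZ hornerXn mulrC.
apply: (is_derive_eq (is_derive_horner _ _)).
rewrite derivZ derivXn /= hornerZ hornerMn hornerXn.
rewrite -[_ *+ N.+1]mulr_natr factS natrM; field.
by rewrite pnatr_eq0 -lt0n fact_gt0 addrC natr1 pnatr_eq0.
Qed.

(** The derivative in [u] of the remainder of order [N.+1] is the remainder of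
    order [N] at [t + pi / 2], so that the bound integrates. *)
Lemma cos_taylor_le N t u : 0 <= u ->
  `|cos (t + u) - (cos_taylor N t).[u]| <= u ^+ N / N`!%:R.
Proof.
elim: N t u => [|N IH] t u u0.
  rewrite expr0 fact0 divr1 /cos_taylor poly_def big_ord0 hornerC subr0.
  exact: cos_max.
pose D v := cos (t + v) - (cos_taylor N.+1 t).[v].
pose dD v := cos (t + pi / 2 + v) - (cos_taylor N (t + pi / 2)).[v].
have hD (v : R) : is_derive v 1 D (dD v).
  rewrite /D; apply: is_deriveB; last first.
    by apply: (is_derive_eq (is_derive_horner _ _)); rewrite deriv_cos_taylor.
  have h1 : is_derive v 1 (fun y => t + y) 1.
    apply: (is_derive_eq (is_deriveD (is_derive_cst t v 1) (is_derive_id v 1))).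
    by rewrite add0r.
  apply: (is_derive_eq (is_derive1_comp (is_derive_cos _) h1)).
  by rewrite mulr1 addrAC cosDpihalf.
have D0 : D 0 = 0.
  rewrite /D addr0 horner_coef0 coef_poly/= mul0r addr0 fact0 divr1.
  exact: subrr.
have hE := is_derive_expn_fact N.
have key s : (s = 1) \/ (s = -1) -> s * D u <= u ^+ N.+1 / N.+1`!%:R.
  move=> s1; rewrite -subr_ge0.
  pose E v := v ^+ N.+1 / N.+1`!%:R - s * D v.
  have -> : 0 = E 0 by rewrite /E expr0n/= mul0r D0 mulr0 subrr.
  apply: (@is_derive_ge0_le _ E (fun v => v ^+ N / N`!%:R - s * dD v)) => //.
  move=> y y0; rewrite subr_ge0 (le_trans (ler_norm _))// normrM.
  have -> : `|s| = 1 by case: s1 => ->; rewrite ?normrN normr1.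
  by rewrite mul1r; exact: IH.
rewrite ler_norml -/(D u).
have := key 1 (or_introl erefl); have := key (-1) (or_intror erefl).
rewrite mulN1r mul1r => ? ->; rewrite andbT lerNl//.
Qed.

End cos_taylor.

Section cos_moment.
Context d (T : measurableType d) (R : realType) (mu : probability T R).
Variables (W : T -> R) (mW : measurable_fun setT W) (W0 : forall x, 0 <= W x).
Hypothesis intW : forall k, mu.-integrable setT (fun x => (W x ^+ (2 * k))%:E).

(** The derivative of order [j] at [t] of the cosine transform of [W].  Writing
    it as an integral spares differentiating under the integral sign. *)
Definition cos_moment j t : R :=
  \int[mu]_x (W x ^+ j * cos (t * W x + j%:R * (pi / 2))).

Let intX j : mu.-integrable setT (fun x => (W x ^+ j)%:E).
Proof.
have h : mu.-integrable setT (fun x => (1 + W x ^+ (2 * j))%:E).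
  under eq_fun do rewrite EFinD.
  by apply: integrableD => //; exact: finite_measure_integrable_cst.
apply: (le_integrable measurableT _ _ h).
  exact/measurable_EFinP/measurable_funX.
move=> x _ /=; rewrite lee_fin !ger0_norm ?addr_ge0 ?exprn_ge0//.
rewrite mulnC exprM; set z := _ ^+ j.
have : 0 <= (z - 1) ^+ 2 by exact: sqr_ge0.
have z0 : 0 <= z by exact: exprn_ge0.
nra.
Qed.

Let integrable_cos_moment j t :
  mu.-integrable setT (fun x => (W x ^+ j * cos (t * W x + j%:R * (pi / 2)))%:E).
Proof.
apply: (le_integrable measurableT _ _ (intX j)).
  apply/measurable_EFinP/measurable_funM; first exact: measurable_funX.
  by apply: measurable_cosT; apply: measurable_funD => //; exact: measurable_funM.
move=> x _ /=; rewrite lee_fin normrM ler_piMr//; exact: cos_max.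
Qed.

(** The bound [cos_taylor_le] at the increment [u * W x], integrated: all the
    derivatives of the transform obey Taylor's formula. *)
Lemma cos_moment_taylor j N t u : 0 <= u ->
  `|cos_moment j (t + u) -
    \sum_(i < N) u ^+ i / i`!%:R * cos_moment (j + i) t| <=
  u ^+ N / N`!%:R * \int[mu]_x (W x ^+ (j + N)).
Proof.
move=> u0.
have intS : mu.-integrable setT (fun x => (\sum_(i < N) u ^+ i / i`!%:R *
    (W x ^+ (j + i) * cos (t * W x + (j + i)%:R * (pi / 2))))%:E).
  under eq_fun do rewrite -sumEFin.
  apply: integrable_sum => // i _; under eq_fun do rewrite EFinM.
  exact: integrableZl.
have -> : \sum_(i < N) u ^+ i / i`!%:R * cos_moment (j + i) t =
    \int[mu]_x (\sum_(i < N) u ^+ i / i`!%:R *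
    (W x ^+ (j + i) * cos (t * W x + (j + i)%:R * (pi / 2)))).
  rewrite /Rintegral; under eq_integral do rewrite -sumEFin.
  rewrite integral_sum//; last first.
    by move=> i; under eq_fun do rewrite EFinM; exact: integrableZl.
  rewrite -sum_fine//; last first.
    move=> i _; apply: integrable_fin_num => //.
    by under eq_fun do rewrite EFinM; exact: integrableZl.
  apply: eq_bigr => i _; rewrite -[LHS]RintegralZl//; exact: integrable_cos_moment.
rewrite -RintegralB//; last exact: integrable_cos_moment.
have intB := integrableB measurableT (integrable_cos_moment j (t + u)) intS.
apply: (le_trans (le_normr_Rintegral measurableT intB)).
rewrite -RintegralZl//; last exact: intX.
apply: le_Rintegral => //.
- exact: (integrable_norm intB).
- exact: (integrableZl measurableT (u ^+ N / N`!%:R) (intX (j + N))).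
- move=> x _.
  have uW : 0 <= u * W x by exact: mulr_ge0.
  have := cos_taylor_le N (t * W x + j%:R * (pi / 2)) uW.
  move=> /(ler_wpM2l (exprn_ge0 j (W0 x))).
  rewrite -[X in X * `|_|]ger0_norm ?exprn_ge0// -normrM mulrBr.
  rewrite horner_poly mulr_sumr => h.
  apply: le_trans (le_trans h _); rewrite le_eqVlt; apply/orP; left; apply/eqP.
    congr (`|_ - _|); first by congr (_ * cos _); ring.
    apply: eq_bigr => i _; rewrite natrD exprD exprMn.
    rewrite (_ : t * W x + (j%:R + i%:R) * (pi / 2) =
                 t * W x + j%:R * (pi / 2) + i%:R * (pi / 2)); first by ring.
    by ring.
  by rewrite exprMn exprD; ring.
Qed.

End cos_moment.

(** * A law on the half-line is determined by its cosine transform *)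

(** The binomial coefficient of [j + N] and [j] is at most [2 ^ (j + N)]. *)
Lemma fact_add_le (j N : nat) : ((j + N)`! <= 2 ^ (j + N) * (j`! * N`!))%N.
Proof.
have jN : (j <= j + N)%N by exact: leq_addr.
rewrite -(bin_fact jN) addKn leq_mul2r; apply/orP; right.
have := expnDn 1 1 (j + N); rewrite addn1 => ->.
have jN' : (j < (j + N).+1)%N by rewrite ltnS.
rewrite (bigD1 (Ordinal jN'))//= !exp1n !muln1; exact: leq_addr.
Qed.

Lemma half_expn_le0 (R : realType) (x K : R) :
  (forall q : nat, x <= K * 2^-1 ^+ q) -> x <= 0.
Proof.
move=> h.
have cv : K * 2^-1 ^+ q @[q --> \oo] --> (0 : R).
  rewrite -[X in _ --> X](mulr0 K); apply: cvgZr; apply: cvg_expr.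
  by rewrite ger0_norm ?invr_ge0// invf_lt1 ?ltr1n.
by apply: (@ler_cvg_to _ _ _ _ (cst x) _ x 0 _ cv); [exact: cvg_cst|exact: nearW].
Qed.

Section cos_transform.
Context d d' (T : measurableType d) (T' : measurableType d') (R : realType).
Context (mu : probability T R) (nu : probability T' R).
Variables (W : T -> R) (V : T' -> R).
Hypotheses (mW : measurable_fun setT W) (mV : measurable_fun setT V).
Hypotheses (W0 : forall x, 0 <= W x) (V0 : forall x, 0 <= V x).
Hypothesis intW : forall k, mu.-integrable setT (fun x => (W x ^+ (2 * k))%:E).
Hypothesis intV : forall k, nu.-integrable setT (fun x => (V x ^+ (2 * k))%:E).
Hypothesis WV : forall k,
  \int[mu]_x (W x ^+ (2 * k)) = \int[nu]_x (V x ^+ (2 * k)).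
Variables (C b : R).
Hypotheses (C0 : 0 <= C) (b0 : 0 < b).
Hypothesis bound : forall k,
  \int[mu]_x (W x ^+ (2 * k)) <= C * b ^+ (2 * k) * (2 * k)`!%:R.

Let eqm t := forall j, cos_moment mu W j t = cos_moment nu V j t.

(** At [0] the odd derivatives vanish and the even ones are even moments. *)
Let eqm0 : eqm 0.
Proof.
move=> j; rewrite /cos_moment.
under eq_Rintegral do rewrite mul0r add0r.
under [RHS]eq_Rintegral do rewrite mul0r add0r.
have [jodd|jeven] := boolP (odd j).
  have cos0 : cos (j%:R * (pi / 2)) = 0 :> R.
    rewrite -(odd_double_half j) jodd natrD mulrDl mul1r addrC cosDpihalf.
    have -> : (j./2.*2)%:R * (pi / 2) = j./2%:R * pi :> R.
      by rewrite -muln2 natrM; field.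
    elim: j./2 => [|k IH]; first by rewrite mul0r sin0 oppr0.
    by rewrite -natr1 mulrDl mul1r sinDpi IH oppr0.
  rewrite cos0; under eq_Rintegral do rewrite mulr0.
  by under [RHS]eq_Rintegral do rewrite mulr0; rewrite !Rintegral_cst// !mul0r.
have -> : j = (2 * j./2)%N.
  by rewrite mul2n -[LHS]odd_double_half (negPf jeven).
by rewrite !RintegralZr ?WV//; [exact: intV|exact: intW].
Qed.

(** The Taylor remainder of order [N] at the increment [u] is, by [fact_add_le],
    a constant times [(2 * u * b) ^ N], at most [2 ^ (- N)]. *)
Let eqm_step t u : 0 <= u -> u * b <= 4^-1 -> eqm t -> eqm (t + u).
Proof.
move=> u0 ub et j; apply/eqP; rewrite -subr_eq0 -normr_le0.
apply: (@half_expn_le0 _ _ (2 * C * b ^+ j * j`!%:R * 2 ^+ j)) => q.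
(* This makes [j + N] even: the moments of odd order are not bounded directly. *)
pose N := (j + 2 * q)%N.
have jN : (j + N)%N = (2 * (j + q))%N by rewrite /N; lia.
have hW := cos_moment_taylor mW W0 intW j N t u0.
have hV := cos_moment_taylor mV V0 intV j N t u0.
have ES : \sum_(i < N) u ^+ i / i`!%:R * cos_moment mu W (j + i) t =
          \sum_(i < N) u ^+ i / i`!%:R * cos_moment nu V (j + i) t.
  by apply: eq_bigr => i _; rewrite et.
rewrite -ES {ES} in hV; rewrite jN -WV in hV; rewrite jN in hW.
have B : u ^+ N / N`!%:R * \int[mu]_x (W x ^+ (2 * (j + q))) <=
         C * b ^+ j * j`!%:R * 2 ^+ j * 2^-1 ^+ q.
  have uN0 : 0 <= u ^+ N / N`!%:R by rewrite divr_ge0 ?exprn_ge0.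
  apply: (le_trans (ler_wpM2l uN0 (bound _))); rewrite -jN.
  have F : ((j + N)`!%:R : R) <= 2 ^+ (j + N) * (j`!%:R * N`!%:R).
    by rewrite -natrX -!natrM ler_nat fact_add_le.
  have NF : (N`!%:R : R) != 0 by rewrite pnatr_eq0 -lt0n fact_gt0.
  apply: (@le_trans _ _ (u ^+ N / N`!%:R * (C * b ^+ (j + N) *
                (2 ^+ (j + N) * (j`!%:R * N`!%:R))))).
    by rewrite ler_wpM2l// ler_wpM2l// mulr_ge0// exprn_ge0// ltW.
  have -> : u ^+ N / N`!%:R * (C * b ^+ (j + N) *
                (2 ^+ (j + N) * (j`!%:R * N`!%:R))) =
            (C * b ^+ j * j`!%:R * 2 ^+ j) * (u * b * 2) ^+ N.
    by rewrite !exprD !exprMn; field.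
  rewrite ler_wpM2l//.
    by rewrite !mulr_ge0// ?exprn_ge0// ltW.
  apply: (@le_trans _ _ (2^-1 ^+ N)).
    have ub0 : 0 <= u * b by rewrite mulr_ge0// ltW.
    by apply: lerXn2r; rewrite ?nnegrE; lra.
  by rewrite ler_wiXn2l//; [lra|rewrite /N; lia].
set S := \sum_(i < N) _ in hW hV.
set a := cos_moment mu W j (t + u) in hW *; set c := cos_moment nu V j (t + u) in hV *.
have -> : a - c = (a - S) - (c - S) by ring.
apply: (le_trans (ler_normB _ _)).
have -> : 2 * C * b ^+ j * j`!%:R * 2 ^+ j * 2^-1 ^+ q =
          (C * b ^+ j * j`!%:R * 2 ^+ j * 2^-1 ^+ q) +
          (C * b ^+ j * j`!%:R * 2 ^+ j * 2^-1 ^+ q) by ring.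
by apply: lerD; [exact: le_trans hW B|exact: le_trans hV B].
Qed.

(** The transforms are real analytic with a radius of convergence bounded below
    uniformly, so equality of all derivatives propagates from [0] by steps of
    fixed length. *)
Lemma cos_transform_eq t : \int[mu]_x cos (t * W x) = \int[nu]_x cos (t * V x).
Proof.
suff H s : 0 <= s -> eqm s.
  wlog t0 : t / 0 <= t => [hw|].
    have [/hw//|t0] := leP 0 t.
    under eq_Rintegral do rewrite -cosN -mulNr.
    under [RHS]eq_Rintegral do rewrite -cosN -mulNr.
    by apply: hw; rewrite oppr_ge0 ltW.
  have := H t t0 0%N; rewrite /cos_moment.
  under eq_Rintegral do rewrite expr0 mul1r mul0r addr0.
  by under [in RHS]eq_Rintegral do rewrite expr0 mul1r mul0r addr0.
move=> s0; pose h := (4 * b)^-1.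
have h0 : 0 < h by rewrite invr_gt0 mulr_gt0.
have hb : h * b = 4^-1 by rewrite /h; field; rewrite gt_eqF.
have eqn (k : nat) : eqm (k%:R * h).
  elim: k => [|k IH]; first by rewrite mul0r.
  by rewrite -natr1 mulrDl mul1r; apply: eqm_step => //; [exact: ltW|rewrite hb].
pose k := Num.truncn (s / h).
have /truncn_itv : 0 <= s / h by rewrite divr_ge0// ltW.
rewrite -/k => /andP[].
rewrite ler_pdivlMr// ltr_pdivrMr// => h1 h2.
have -> : s = k%:R * h + (s - k%:R * h) by ring.
apply: eqm_step => //; first by rewrite subr_ge0.
rewrite -hb ler_wpM2r//; first exact: ltW.
by rewrite lerBlDl; rewrite -natr1 mulrDl mul1r in h2; exact: ltW.
Qed.

End cos_transform.

Section step_limit.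
Variable R : realType.
Implicit Types (x y c : R) (n : nat).

Lemma bernoulli_ge x n : -1 <= x -> 1 + n%:R * x <= (1 + x) ^+ n.
Proof.
move=> x1; elim: n => [|n IH]; first by rewrite mul0r addr0 expr0.
rewrite exprS; have x0 : 0 <= 1 + x by lra.
apply: le_trans (ler_wpM2l x0 IH).
have : 0 <= n%:R * x ^+ 2 by rewrite mulr_ge0// sqr_ge0.
rewrite -natr1; nra.
Qed.

Lemma onem_expr_le x n : 0 <= x -> x <= 1 -> (1 - x) ^+ n <= (1 + n%:R * x)^-1.
Proof.
move=> x0 x1.
have p : 0 < 1 + n%:R * x by rewrite ltr_pwDl// mulr_ge0.
have q : 0 < (1 + x) ^+ n by rewrite exprn_gt0//; lra.
apply: (@le_trans _ _ ((1 + x) ^+ n)^-1).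
  rewrite -(ler_pM2r q) mulVf ?gt_eqF// -exprMn exprn_ile1//; nra.
by rewrite lef_pV2 ?posrE//; apply: bernoulli_ge; lra.
Qed.

Lemma cvg_natr_expr x : 0 <= x -> x < 1 -> n%:R * x ^+ n @[n --> \oo] --> (0 : R).
Proof.
move=> x0 x1; have [->|xn0] := eqVneq x 0.
  apply: cvg_near_cst; near=> n; rewrite expr0n [(n == 0)%N]negbTE ?mulr0//.
  by rewrite -lt0n; near: n; exact: nbhs_infty_gt.
pose r := Num.sqrt x.
have r0 : 0 < r by rewrite sqrtr_gt0 lt_neqAle eq_sym xn0.
have r1 : r < 1 by rewrite -sqrtr1 ltr_sqrt.
have xE : x = r * r by rewrite -expr2 sqr_sqrtr.
pose K := (r^-1 - 1)^-1.
have K0 : 0 < r^-1 - 1 by rewrite subr_gt0 invf_gt1.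
have nr n : n%:R * r ^+ n <= K.
  have h : 1 + n%:R * (r^-1 - 1) <= r^-1 ^+ n.
    rewrite [in leRHS](_ : r^-1 = 1 + (r^-1 - 1)); last by ring.
    by apply: bernoulli_ge; lra.
  have rn : 0 < r ^+ n by exact: exprn_gt0.
  rewrite /K -[leRHS]div1r ler_pdivlMr// mulrAC -ler_pdivlMr// div1r -exprVn.
  by apply: le_trans h; rewrite ler_wpDl.
apply: (@squeeze_cvgr _ _ _ _ (cst 0) (fun n => K * r ^+ n)).
- apply: nearW => n /=; rewrite mulr_ge0 ?exprn_ge0//=.
  by rewrite xE exprMn mulrA ler_wpM2r// exprn_ge0// ltW.
- exact: cvg_cst.
- rewrite -[X in _ --> X](mulr0 K); apply: cvgZr; apply: cvg_expr.
  by rewrite ger0_norm// ltW.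
Unshelve. all: by end_near. Qed.

(** About [n / c ^+ n]: multiplied by [y ^+ n] it tends to [0] when [y < c],
    and is at least [n] when [c <= y], so that [(1 - y ^+ n) ^+ _] tends to [1]
    in the first case and to [0] in the second. *)
Definition step_exponent c n : nat := (Num.truncn (n%:R / c ^+ n)).+1.

Definition soft_step c n y : R := (1 - y ^+ n) ^+ step_exponent c n.

Lemma soft_step_itv c n y : 0 <= y -> y <= 1 -> 0 <= soft_step c n y <= 1.
Proof.
move=> y0 y1; have yn1 : y ^+ n <= 1 by rewrite exprn_ile1.
have yn0 : 0 <= y ^+ n by rewrite exprn_ge0.
by apply/andP; split; [rewrite exprn_ge0//|rewrite exprn_ile1//]; lra.
Qed.

Lemma cvg_soft_step c y : 0 < c -> c <= 1 -> 0 <= y -> y <= 1 ->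
  soft_step c n y @[n --> \oo] --> ((y < c)%R%:R : R).
Proof.
move=> c0 c1 y0 y1; rewrite /soft_step.
have cn0 n : 0 < c ^+ n by exact: exprn_gt0.
have yn0 n : 0 <= y ^+ n by exact: exprn_ge0.
have yn1 n : y ^+ n <= 1 by rewrite exprn_ile1.
have Ngt n : n%:R / c ^+ n < (step_exponent c n)%:R by exact: truncnS_gt.
have Nle n : (step_exponent c n)%:R <= n%:R / c ^+ n + 1.
  rewrite -natr1 lerD2r truncn_le ?divr_ge0//; exact: ltW.
have [yc|cy] := ltP y c.
  apply: (@squeeze_cvgr _ _ _ _ (fun n => 1 - (n%:R * (y / c) ^+ n + y ^+ n)) (cst 1)).
  - apply: nearW => n /=; apply/andP; split; last first.
      by case/andP: (soft_step_itv c n y0 y1).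
    apply: (@le_trans _ _ (1 + (step_exponent c n)%:R * (- y ^+ n))); last first.
      by apply: bernoulli_ge; have := yn1 n; lra.
    rewrite mulrN lerD2l lerN2 expr_div_n.
    have := ler_wpM2r (yn0 n) (Nle n).
    by move=> h; apply: (le_trans h); rewrite mulrDl mul1r lerD2r mulrAC mulrA.
  - rewrite -[X in _ --> X](subr0 1); apply: cvgB; first exact: cvg_cst.
    rewrite -[X in _ --> X](addr0 0); apply: cvgD.
      by apply: cvg_natr_expr; rewrite ?divr_ge0 ?ltr_pdivrMr ?mul1r// ltW.
    by apply: cvg_expr; rewrite ger0_norm// (lt_le_trans yc).
  - exact: cvg_cst.
apply: (@squeeze_cvgr _ _ _ _ (cst 0) (@harmonic R)).
- apply: nearW => n /=; apply/andP; split.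
    by case/andP: (soft_step_itv c n y0 y1).
  apply: (le_trans (onem_expr_le _ (yn0 n) (yn1 n))).
  rewrite lef_pV2 ?posrE ?ltr_pwDl ?mulr_ge0//.
  rewrite -natr1 addrC lerD2l.
  apply: (@le_trans _ _ (n%:R / c ^+ n * y ^+ n)).
    rewrite -mulrA ler_peMr// mulrC -expr_div_n exprn_ege1//.
    by rewrite ler_pdivlMr// mul1r.
  by rewrite ler_wpM2r// ltW.
- exact: cvg_cst.
- exact: cvg_harmonic.
Qed.

End step_limit.

Section cos_transform_inj.
Context d d' (T : measurableType d) (T' : measurableType d') (R : realType).
Context (mu : probability T R) (nu : probability T' R).
Variables (W : T -> R) (V : T' -> R).
Hypotheses (mW : measurable_fun setT W) (mV : measurable_fun setT V).
Hypotheses (W0 : forall x, 0 <= W x) (V0 : forall x, 0 <= V x).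
Hypothesis cosWV : forall t,
  \int[mu]_x cos (t * W x) = \int[nu]_x cos (t * V x).

(** The bound by [1] is what dominated convergence uses. *)
Let same (h : R -> R) :=
  [/\ measurable_fun setT h, (forall x, `|h x| <= 1) &
      \int[mu]_x h (W x) = \int[nu]_x h (V x)].

Let same_cvg (h_ : nat -> R -> R) (h : R -> R) :
  (forall n, same (h_ n)) -> measurable_fun setT h ->
  (forall x, 0 <= x -> h_ n x @[n --> \oo] --> h x) ->
  \int[mu]_x h (W x) = \int[nu]_x h (V x).
Proof.
move=> sh mh cvh.
have cvW : \int[mu]_x h_ n (W x) @[n --> \oo] --> \int[mu]_x h (W x).
  apply: (@dominated_cvg_Rintegral _ _ _ mu setT _ _ (cst 1) _ _ _ _ _).2 => //.
  - by move=> n; apply: measurableT_comp => //; have [] := sh n.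
  - by move=> x _; exact: cvh.
  - exact: finite_measure_integrable_cst.
  - by move=> n x _; have [] := sh n.
have cvV : \int[nu]_x h_ n (V x) @[n --> \oo] --> \int[nu]_x h (V x).
  apply: (@dominated_cvg_Rintegral _ _ _ nu setT _ _ (cst 1) _ _ _ _ _).2 => //.
  - by move=> n; apply: measurableT_comp => //; have [] := sh n.
  - by move=> x _; exact: cvh.
  - exact: finite_measure_integrable_cst.
  - by move=> n x _; have [] := sh n.
suff E : (fun n => \int[mu]_x h_ n (W x)) = (fun n => \int[nu]_x h_ n (V x)).
  by move: cvW; rewrite E => /cvg_lim <- //; apply/cvg_lim.
by apply/funext => n; have [] := sh n.
Qed.

Let same_int (h : R -> R) : same h ->
  mu.-integrable setT (EFin \o (h \o W)) /\ nu.-integrable setT (EFin \o (h \o V)).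
Proof.
move=> [mh h1 _]; split; apply: (@bounded_prob_integrable _ _ _ _ _ 1).
- exact: measurableT_comp.
- by move=> x; exact: h1.
- exact: measurableT_comp.
- by move=> x; exact: h1.
Qed.

Let sameD a b h k : same h -> same k ->
  (forall x, `|a * h x + b * k x| <= 1) -> same (fun x => a * h x + b * k x).
Proof.
move=> sh sk hk; have [iW iV] := same_int sh; have [jW jV] := same_int sk.
have [mh h1 Eh] := sh; have [mk k1 Ek] := sk; split => //.
  by apply: measurable_funD; exact: measurable_funM.
rewrite !RintegralD//.
- by rewrite !RintegralZl// Eh Ek.
- exact: (integrableZl measurableT a iV).
- exact: (integrableZl measurableT b jV).
- exact: (integrableZl measurableT a iW).
- exact: (integrableZl measurableT b jW).
Qed.

Let y th x : R := (1 - cos (th * x)) / 2.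

Let y_itv th x : 0 <= y th x <= 1.
Proof. by rewrite /y; have := cos_le1 (th * x); have := cos_geN1 (th * x); lra. Qed.

Let norm_le1 (z w : R) : `|z| <= 1 -> 0 <= w <= 1 -> `|z * w| <= 1.
Proof. by move=> z1 /andP[w0 w1]; rewrite normrM mulr_ile1// ger0_norm. Qed.

Let itv_expr (z : R) n : 0 <= z <= 1 -> 0 <= z ^+ n <= 1.
Proof. by move=> /andP[? ?]; rewrite exprn_ge0 ?exprn_ile1. Qed.

(** Multiplication by [cos (th * x)] keeps the span of the cosines stable, as
    [2 * cos u * cos v = cos (u + v) + cos (u - v)]. *)
Let same_cos_expr th m t : same (fun x => cos (t * x) * y th x ^+ m).
Proof.
elim: m t => [|m IH] t.
  split => [|x|].
  - apply: measurable_funM => //.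
    by apply: measurable_cosT; exact: measurable_funM.
  - by rewrite expr0 mulr1 cos_max.
  - under eq_Rintegral do rewrite expr0 mulr1.
    by under [RHS]eq_Rintegral do rewrite expr0 mulr1; exact: cosWV.
have E x : cos (t * x) * y th x ^+ m.+1 =
   1 * (2^-1 * (cos (t * x) * y th x ^+ m) +
        - 4^-1 * (cos ((t + th) * x) * y th x ^+ m)) +
   - 4^-1 * (cos ((t - th) * x) * y th x ^+ m).
  rewrite (mulrDl t th) (mulrBl x t th) cosD cosB exprS {1}/y; by field.
have B x (a : R) k : `|cos (a * x) * y th x ^+ k| <= 1.
  by apply: norm_le1; [exact: cos_max|exact/itv_expr/y_itv].
rewrite (_ : (fun x => _) = (fun x => 1 * (2^-1 * (cos (t * x) * y th x ^+ m) +
        - 4^-1 * (cos ((t + th) * x) * y th x ^+ m)) +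
   - 4^-1 * (cos ((t - th) * x) * y th x ^+ m))); last exact/funext/E.
apply: (@sameD _ _ (fun x => 2^-1 * (cos (t * x) * y th x ^+ m) +
        - 4^-1 * (cos ((t + th) * x) * y th x ^+ m))) => //.
- apply: (@sameD _ _ (fun x => cos (t * x) * y th x ^+ m)) => // x.
  have := B x t m; have := B x (t + th) m; rewrite !ler_norml; lra.
- by move=> x; rewrite -E; exact: B.
Qed.

Let same_onem_expr th n N m : same (fun x => (1 - y th x ^+ n) ^+ N * y th x ^+ m).
Proof.
elim: N m => [|N IH] m.
  have := same_cos_expr th m 0; congr same; apply/funext => x.
  by rewrite mul0r cos0 expr0.
have E x : (1 - y th x ^+ n) ^+ N.+1 * y th x ^+ m =
    1 * ((1 - y th x ^+ n) ^+ N * y th x ^+ m) +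
    -1 * ((1 - y th x ^+ n) ^+ N * y th x ^+ (m + n)).
  by rewrite exprS exprD; ring.
rewrite (_ : (fun x => _) = fun x => 1 * ((1 - y th x ^+ n) ^+ N * y th x ^+ m) +
    -1 * ((1 - y th x ^+ n) ^+ N * y th x ^+ (m + n))); last exact/funext/E.
apply: sameD => // x; rewrite -E; apply: norm_le1; last exact/itv_expr/y_itv.
have /andP[? ?] := itv_expr n (y_itv th x).
rewrite ger0_norm; last by rewrite exprn_ge0//; lra.
by rewrite exprn_ile1//; lra.
Qed.

Let measurable_y th : measurable_fun setT (y th).
Proof.
apply: measurable_funM => //; apply: measurable_funB => //.
by apply: measurable_cosT; exact: measurable_funM.
Qed.

Let measurable_indic_lt (f g : R -> R) : measurable_fun setT f ->
  measurable_fun setT g -> measurable_fun setT (fun x => ((f x < g x)%R%:R : R)).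
Proof.
move=> mf mg; rewrite (_ : (fun x => _) = fun x => if f x < g x then 1 else 0).
  by apply: measurable_fun_ifT => //; exact: measurable_fun_ltr.
by apply/funext => x; case: ifP.
Qed.

Let same_step th c : 0 < c -> c <= 1 -> same (fun x => (y th x < c)%R%:R).
Proof.
move=> c0 c1.
have mI : measurable_fun setT (fun x => ((y th x < c)%R%:R : R)).
  by apply: measurable_indic_lt => //; exact: measurable_y.
split => //; first by move=> x; case: (_ < _); rewrite ?normr1 ?normr0.
apply: (@same_cvg (fun n x => soft_step c n (y th x))
  (fun x => (y th x < c)%R%:R)) => //.
- move=> n; have := same_onem_expr th n (step_exponent c n) 0; congr same.
  by apply/funext => x; rewrite expr0 mulr1.
- by move=> x _; have /andP[? ?] := y_itv th x; exact: cvg_soft_step.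
Qed.

(** Powers of [(1 - cos (th * x)) / 2] approximate the indicator of
    [cos (th * x) > cos (th * a)], which for small [th] is that of [x < a]
    on any bounded interval. *)
Lemma cos_transform_inj (a : R) : 0 < a -> mu [set x | W x < a] = nu [set x | V x < a].
Proof.
move=> a0.
have mI : measurable_fun setT (fun x : R => ((x < a)%R%:R : R)) by exact: measurable_indic_lt.
have : \int[mu]_x ((W x < a)%R%:R) = \int[nu]_x ((V x < a)%R%:R).
  pose th (k : nat) := (a * k.+1%:R)^-1.
  have th0 k : 0 < th k by rewrite invr_gt0 mulr_gt0.
  have tha k : th k * a = k.+1%:R^-1.
    by rewrite /th invfM mulrC mulrA divff ?mul1r ?gt_eqF.
  have tha1 k : th k * a <= 1 by rewrite tha invf_le1 ?ler1n.
  have pi1 : 1 < pi :> R by have := @pi_ge2 R; lra.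
  have tha' k : 0 <= th k * a <= pi.
    by rewrite (le_trans (tha1 k) (ltW pi1)) andbT mulr_ge0// ltW.
  apply: (@same_cvg (fun k x => (y (th k) x < y (th k) a)%R%:R)
    (fun x => (x < a)%R%:R)) => //.
    move=> k; apply: same_step; last by case/andP: (y_itv (th k) a).
    rewrite /y divr_gt0// subr_gt0 -[ltRHS]cos0.
    by rewrite ltr_cos ?in_itv/= ?lexx ?pi_ge0 ?tha' ?mulr_gt0.
  move=> x x0; apply: cvg_near_cst; near=> k.
  have thx : 0 <= th k * x <= pi.
    have xk : x / a <= k.+1%:R.
      by apply: (@le_trans _ _ k%:R); [near: k; exact: nbhs_infty_ger|rewrite ler_nat].
    rewrite mulr_ge0//=; last exact: ltW.
    apply: (le_trans _ (ltW pi1)).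
    rewrite /th mulrC ler_pdivrMr ?mulr_gt0//.
    by rewrite mul1r mulrC -ler_pdivrMr.
  by rewrite /y ltr_pM2r// ltrD2l ltrN2 ltr_cos ?in_itv/= ?thx ?tha'// ltr_pM2l.
have mS d0 (S : measurableType d0) (U : S -> R) :
    measurable_fun setT U -> measurable [set x | U x < a].
  move=> mU; rewrite -[X in measurable X]setTI.
  rewrite (_ : [set x | U x < a] = U @^-1` `]-oo, a[); first exact: mU.
  by apply/seteqP; split => x /=; rewrite in_itv.
have E d0 (S : measurableType d0) (m : probability S R) (U : S -> R) :
    measurable_fun setT U ->
    \int[m]_x ((U x < a)%R%:R) = fine (m [set x | U x < a]).
  move=> mU; rewrite /Rintegral; congr fine.
  rewrite -[in RHS](setIT [set x | U x < a]) -integral_indic//; last exact: mS.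
  apply: eq_integral => x _; congr EFin; rewrite indicE; congr (_%:R).
  by congr nat_of_bool; apply/idP/idP; rewrite inE.
rewrite !E// => Eq; have := congr1 EFin Eq.
by rewrite !fineK// fin_num_measure//; exact: mS.
Unshelve. all: end_near. Qed.

End cos_transform_inj.

(** * Hardy's criterion *)

Section hardy.
Context (R : realType).
Implicit Types mu nu : probability R R.

Lemma eq_probability_ray mu nu :
  (forall a, mu `]-oo, a[%classic = nu `]-oo, a[%classic) ->
  forall A, measurable A -> mu A = nu A.
Proof.
move=> H A mA.
apply: (measure_unique (@RGenInftyO.G R) (fun n => `]-oo, n%:R[%classic)) => //.
- exact: RGenInftyO.measurableE.
- move=> _ _ [x ->] [y ->]; exists (Num.min x y).
  by apply/seteqP; split => z /=; rewrite !in_itv/= lt_min; [case=> -> ->|move/andP].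
- by move=> n; exists n%:R.
- apply/seteqP; split => // z _; exists (Num.truncn z).+1 => //=.
  by rewrite in_itv/= truncnS_gt.
- by move=> _ [x ->]; exact: H.
- by move=> n; rewrite ltey_eq fin_num_measure.
Qed.

Lemma supported_nonneg_neg mu : supported_nonneg mu -> mu `]-oo, 0[%classic = 0%E.
Proof.
move=> h; rewrite -setCitvr probability_setC//.
by rewrite [X in (1 - X)%E]h subee.
Qed.

Lemma supported_nonneg_ae mu : supported_nonneg mu -> {ae mu, forall x, 0 <= x}.
Proof.
move=> h; exists `]-oo, 0[%classic; split => //; first exact: supported_nonneg_neg.
by move=> x /= /negP; rewrite -ltNge in_itv.
Qed.

Let measurable_sqrtX k : measurable_fun setT (fun x : R => Num.sqrt x ^+ k).
Proof.
apply: measurable_funX; apply: continuous_measurable_fun; exact: sqrt_continuous.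
Qed.

Let integral_sqrtX mu k : supported_nonneg mu ->
  (\int[mu]_x (Num.sqrt x ^+ (2 * k))%:E = moment mu k)%E.
Proof.
move=> h; apply: ae_eq_integral => //.
- exact/measurable_EFinP.
- by apply/measurable_EFinP; exact: measurable_funX.
apply: filterS (supported_nonneg_ae h) => x x0 _.
by rewrite exprM sqr_sqrtr.
Qed.

Let integrable_sqrtX mu k : supported_nonneg mu -> (moment mu k < +oo)%E ->
  mu.-integrable setT (fun x => (Num.sqrt x ^+ (2 * k))%:E).
Proof.
move=> h kfin; apply/integrableP; split; first exact/measurable_EFinP.
under eq_integral do rewrite gee0_abs ?lee_fin ?exprn_ge0//.
by rewrite integral_sqrtX.
Qed.

(** The moments are the Taylor coefficients at [0] of the cosine transform of
    the square root, up to factors depending on the order only. *)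
Theorem hardy_determinacy mu nu (C b : R) :
  supported_nonneg mu -> supported_nonneg nu -> 0 <= C -> 0 < b ->
  (forall k, (moment mu k <= (C * b ^+ (2 * k) * (2 * k)`!%:R)%:E)%E) ->
  (forall k, moment nu k = moment mu k) ->
  forall A, measurable A -> nu A = mu A.
Proof.
move=> hmu hnu C0 b0 bound eqm A mA; apply/esym; move: A mA; apply: eq_probability_ray.
have fin k : (moment mu k < +oo)%E by rewrite (le_lt_trans (bound k)) ?ltry.
have ms : measurable_fun setT (@Num.sqrt R) := measurable_sqrtX 1.
have i1 k := integrable_sqrtX hmu (fin k).
have i2 k : nu.-integrable setT (fun x => (Num.sqrt x ^+ (2 * k))%:E).
  by apply: integrable_sqrtX => //; rewrite eqm.
have := cos_transform_eq ms ms (@sqrtr_ge0 R) (@sqrtr_ge0 R) i1 i2 _ C0 b0 _.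
move=> cosE.
have {}cosE t : \int[mu]_x cos (t * Num.sqrt x) = \int[nu]_x cos (t * Num.sqrt x).
  apply: cosE => k.
    by rewrite /Rintegral !integral_sqrtX// eqm.
  rewrite /Rintegral integral_sqrtX// -lee_fin fineK//.
  by rewrite ge0_fin_numE// -integral_sqrtX// integral_ge0// => x _; rewrite lee_fin exprn_ge0.
have rays := cos_transform_inj ms ms (@sqrtr_ge0 R) (@sqrtr_ge0 R) cosE.
move=> a; have [a0|a0] := leP a 0.
  have z m : supported_nonneg m -> m `]-oo, a[%classic = 0%E.
    move=> h; apply/eqP; rewrite -measure_le0 -(supported_nonneg_neg h).
    by rewrite le_measure ?inE//; apply: subset_itvl; rewrite bnd_simp.
  by rewrite !z.
have := rays (Num.sqrt a) _; rewrite sqrtr_gt0 => /(_ a0).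
rewrite (_ : [set x | _] = `]-oo, a[%classic)//.
by apply/seteqP; split => x /=; rewrite in_itv/= ltr_sqrt.
Qed.

End hardy.

Section admissibility.
Context (R : realType) d (T : measurableType d) (P : probability T R).
Variable U : {RV P >-> R}.

Lemma supported_nonneg_distribution :
  {ae P, forall t, 0 <= U t} -> supported_nonneg (distribution P U).
Proof.
move=> [N [mN N0 sN]].
have mI : measurable (U @^-1` `]-oo, 0[).
  by rewrite -[X in measurable X]setTI; exact: measurable_funP.
have U0 : distribution P U `]-oo, 0[%classic = 0%E.
  apply: (subset_measure0 mI mN _ N0) => t /=; rewrite in_itv/= => Ut.
  by apply: sN => /=; apply/negP; rewrite -ltNge.
rewrite /supported_nonneg -setCitvl probability_setC//.
by rewrite [X in (1 - X)%E]U0 sube0.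
Qed.

Lemma finite_moments_distribution :
  (forall j, P.-integrable setT (fun t => (U t ^+ j)%:E)) ->
  finite_moments (distribution P U).
Proof.
move=> h j; apply: integrable_pushforward => //.
  by apply/measurable_EFinP; exact: measurable_funX.
by rewrite preimage_setT; exact: h.
Qed.

Lemma moment_distribution j :
  P.-integrable setT (fun t => (U t ^+ j)%:E) ->
  moment (distribution P U) j = (\int[P]_t (U t ^+ j))%:E.
Proof.
move=> h; rewrite /moment integral_distribution//.
  by rewrite /Rintegral fineK//; exact: integrable_fin_num.
by apply/measurable_EFinP; exact: measurable_funX.
Qed.

Lemma hardy_M_det (C b : R) : stieltjes_admissible U -> 0 <= C -> 0 < b ->
  (forall j, P.-integrable setT (fun t => (U t ^+ j)%:E)) ->
  (forall j, \int[P]_t (U t ^+ j) <= C * b ^+ (2 * j) * (2 * j)`!%:R) ->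
  M_det U.
Proof.
move=> aU C0 b0 iU bU; split=> // nu hnu hm.
apply: (hardy_determinacy aU.1 hnu C0 b0) => // j.
by rewrite moment_distribution// lee_fin.
Qed.

End admissibility.

(** * The fundamental theorem of calculus on the open half-line *)

Section FTC_half_line.
Context (R : realType) (G g : R -> R).
Local Notation mu := (@lebesgue_measure R).
Local Notation D := (`]0, +oo[%classic : set R).
Hypothesis dG : forall x : R, 0 < x -> is_derive x 1 G (g x).
Hypothesis cg : forall x : R, 0 < x -> {for x, continuous g}.

(* These intervals stay away from [0], where [g] may be unbounded. *)
Let I n : set R := `[n.+2%:R^-1, n.+2%:R]%classic.

Let I_gt0 n x : I n x -> 0 < x.
Proof. by rewrite /I/= in_itv/= => /andP[h _]; apply: lt_le_trans h; rewrite invr_gt0. Qed.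

Let nondecreasing_I n m : (n <= m)%N -> I n `<=` I m.
Proof.
move=> nm x; rewrite /I/= !in_itv/= => /andP[h1 h2]; apply/andP; split.
  by apply: le_trans h1; rewrite lef_pV2 ?posrE// ler_nat.
by apply: (le_trans h2); rewrite ler_nat.
Qed.

Let near_I (x : R) : 0 < x -> \forall n \near \oo, I n x.
Proof.
move=> x0; near=> n; rewrite /I/= in_itv/=.
have n2 : (n%:R : R) <= n.+2%:R by rewrite ler_nat; lia.
apply/andP; split; last by apply: le_trans n2; near: n; exact: nbhs_infty_ger.
rewrite -[leRHS]invrK lef_pV2 ?posrE ?invr_gt0//.
by apply: le_trans n2; near: n; exact: nbhs_infty_ger.
Unshelve. all: by end_near. Qed.

Let bigcup_I : \bigcup_n I n = D.
Proof.
apply/seteqP; split => x /=.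
  by move=> [n _ /I_gt0 x0]; rewrite in_itv/= x0.
rewrite in_itv/= andbT => x0; have [n _ h] := near_I x0.
by exists n => //; apply: h => /=.
Qed.

Let FTC_I n : (\int[mu]_(x in I n) (g x)%:E = (G n.+2%:R - G n.+2%:R^-1)%:E)%E.
Proof.
have a0 : 0 < (n.+2%:R^-1 : R) by rewrite invr_gt0.
have ab : (n.+2%:R^-1 : R) < n.+2%:R.
  by rewrite (@lt_trans _ _ 1)// ?invf_lt1 ?ltr1n.
have cG (x : R) : 0 < x -> {for x, continuous G}.
  move=> x0; apply/differentiable_continuous/derivable1_diffP.
  exact: (@ex_derive _ _ _ _ _ _ _ (dG x0)).
rewrite EFinB; apply: continuous_FTC2 => //.
- apply: continuous_in_subspaceT => x; rewrite inE => /I_gt0 x0; exact: cg.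
- split.
  + move=> x; rewrite in_itv/= => /andP[h _].
    exact: (@ex_derive _ _ _ _ _ _ _ (dG (lt_trans a0 h))).
  + exact/cvg_at_right_filter/cG.
  + by apply/cvg_at_left_filter/cG; exact: lt_trans ab.
- move=> x; rewrite in_itv/= => /andP[h _]; rewrite derive1E.
  exact: (@derive_val _ _ _ _ _ _ _ (dG (lt_trans a0 h))).
Qed.

Let mg : measurable_fun D g.
Proof.
apply: open_continuous_measurable_fun; first exact: interval_open.
by move=> x; rewrite inE/= in_itv/= andbT; exact: cg.
Qed.

Let IS n : I n `<=` D.
Proof. by move=> x /I_gt0 x0; rewrite /= in_itv/= x0. Qed.

(** Over each [I n] the integral of [g] is a difference of two values of [G],
    hence at most [M + M]. *)
Lemma FTC_integrable (M : R) : (forall x, 0 < x -> 0 <= g x) ->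
  (forall x, 0 < x -> `|G x| <= M) ->
  mu.-integrable D (EFin \o g).
Proof.
move=> g0 GM; apply/integrableP; split; first exact/measurable_EFinP.
have -> : (\int[mu]_(x in D) `|(EFin \o g) x| = \int[mu]_(x in D) (g x)%:E)%E.
  apply: eq_integral => x; rewrite inE/= in_itv/= andbT => x0.
  by rewrite ger0_norm// g0.
rewrite -bigcup_I.
have cv : (\int[mu]_(x in I i) (g x)%:E @[i --> \oo] -->
    \int[mu]_(x in \bigcup_i I i) (g x)%:E)%E.
  apply: ge0_nondecreasing_set_cvg_integral.
  - by move=> n m nm; rewrite subsetEset; exact: nondecreasing_I.
  - by move=> n; exact: measurable_itv.
  - move=> n; apply/measurable_EFinP; apply: (measurable_funS _ (@IS n)) => //.
  - by move=> n x /I_gt0 x0; rewrite lee_fin g0.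
apply: (@le_lt_trans _ _ (M + M)%:E); last exact: ltry.
apply: (cvge_to_le cv); apply: nearW => n; rewrite FTC_I lee_fin.
apply: (le_trans (ler_norm _)); apply: (le_trans (ler_normB _ _)).
by apply: lerD; apply: GM; rewrite ?invr_gt0.
Qed.

Lemma FTC_half_line (A B : R) :
  mu.-integrable D (EFin \o g) ->
  G x @[x --> 0^'+] --> A -> G x @[x --> +oo] --> B ->
  \int[mu]_(x in D) g x = B - A.
Proof.
move=> ig GA GB.
have cv : \int[mu]_(x in D) (g \_ (I n)) x @[n --> \oo] --> \int[mu]_(x in D) g x.
  apply: (@dominated_cvg_Rintegral _ _ _ mu D (fun n => g \_ (I n)) g
    (fun x => `|g x|) _ _ _ _ _).2 => //.
  - move=> n; apply/measurable_funTS.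
    apply/(measurable_restrictT _ _).1; first exact: measurable_itv.
    by apply: (measurable_funS _ (@IS n)).
  - move=> x; rewrite /= in_itv/= andbT => x0; apply: cvg_near_cst.
    near=> n; rewrite patchE mem_set//; near: n; exact: near_I.
  - exact: integrable_norm.
  - by move=> n x _; rewrite patchE; case: ifP; rewrite ?normr0.
have E n : \int[mu]_(x in D) (g \_ (I n)) x = G n.+2%:R - G n.+2%:R^-1.
  rewrite -Rintegral_mkcondr setIidr; last exact: IS.
  by rewrite /Rintegral FTC_I.
move: cv; under eq_fun do rewrite E.
move=> cv; apply: (cvg_unique _ cv) => //.
apply: cvgB.
  have /cvg_pinftyP := GB; apply.
  apply/cvgryPge => M; near=> n.
  apply: (@le_trans _ _ n%:R); last by rewrite ler_nat; lia.
  by near: n; exact: nbhs_infty_ger.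
have /cvg_at_rightP := GA; apply; split; first by move=> n; rewrite invr_gt0.
apply: (@squeeze_cvgr _ _ _ _ (cst 0) (@harmonic R)).
- by apply: nearW => n /=; rewrite invr_ge0 ler0n/= lef_pV2 ?posrE// ler_nat.
- exact: cvg_cst.
- exact: cvg_harmonic.
Unshelve. all: by end_near. Qed.

End FTC_half_line.

(** * Rotating the contour in the Gamma integral *)

Section gg_integrals.
Context (R : realType).
Local Notation mu := (@lebesgue_measure R).
Local Notation D := (`]0, +oo[%classic : set R).

(** For [x >= 1], [x `^ p] is at most a power of [x `^ be] of integral exponent,
    hence bounded by a term of the exponential series. *)
Lemma powR_le_expR (p de be : R) : 0 <= p -> 0 < de -> 0 < be ->
  exists2 K : R, 0 < K & forall x, 0 < x -> x `^ p <= K * expR (de * x `^ be).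
Proof.
move=> p0 de0 be0; pose N := (Num.truncn (p / be)).+1.
have pN : p <= be * N%:R.
  by rewrite mulrC -ler_pdivrMr//; apply/ltW; exact: truncnS_gt.
have deN : 0 < de ^+ N by exact: exprn_gt0.
pose K := 1 + N`!%:R / de ^+ N.
have K1 : 1 <= K by rewrite lerDl divr_ge0// ltW.
exists K => [|x x0]; first exact: lt_le_trans K1.
have xb : 0 < x `^ be by exact: powR_gt0.
have e1 : 1 <= expR (de * x `^ be) by rewrite -expR0 ler_expR mulr_ge0// ltW.
have [x1|x1] := leP x 1.
  apply: (@le_trans _ _ 1); last by rewrite -[leLHS]mulr1 ler_pM.
  have := @ger_powR _ x; rewrite x0 x1 => /(_ isT)/(_ _ _ p0).
  by rewrite powRr0.
apply: (le_trans (ler_powR (ltW x1) pN)).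
rewrite powRrM powR_mulrn; last exact: ltW.
have := @expR_ge1Dxn R (de * x `^ be) (Num.truncn (p / be))
  (mulr_ge0 (ltW de0) (ltW xb)).
rewrite -/N exprMn => h.
have {}h : de ^+ N * x `^ be ^+ N / N`!%:R <= expR (de * x `^ be) by lra.
move: h; rewrite ler_pdivrMr ?ltr0n ?fact_gt0// mulrC -ler_pdivlMr// => h.
apply: (le_trans h); rewrite /K mulrDl mul1r.
by rewrite mulrAC mulrC [leLHS]mulrC ler_wpDl ?expR_ge0// mulrC -!mulrA [_^-1 * _]mulrC.
Qed.

Lemma continuous_powR_gt0 (p x : R) : 0 < x -> {for x, continuous (@powR R ^~ p)}.
Proof.
move=> x0; apply/differentiable_continuous/derivable1_diffP.
exact: (@ex_derive _ _ _ _ _ _ _ (is_derive1_powR p x0)).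
Qed.

(** The integrand is at most a multiple of the derivative of the bounded function
    [- (1 + x `^ s)^-1], which has the right behavior [x `^ (s - 1)] at [0]. *)
Lemma integrable_powR_expR (s de be : R) : 0 < s -> 0 < de -> 0 < be ->
  mu.-integrable D (fun x => (x `^ (s - 1) * expR (- (de * x `^ be)))%:E).
Proof.
move=> s0 de0 be0.
have [K1 K10 hK1] := powR_le_expR (ltW s0) de0 be0.
have [K2 K20 hK2] := powR_le_expR (ltW (addr_gt0 s0 s0)) de0 be0.
pose g x := s * x `^ (s - 1) / (1 + x `^ s) ^+ 2.
have p1 x : 0 < 1 + x `^ s by rewrite ltr_pwDl// powR_ge0.
have ig : mu.-integrable D (EFin \o g).
  apply: (@FTC_integrable _ (fun x => - (1 + x `^ s)^-1) _ _ _ 1).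
  - move=> x x0.
    have h : is_derive x 1 (fun y => 1 + y `^ s) (s * x `^ (s - 1)).
      apply: (is_derive_eq (is_deriveD (is_derive_cst (1 : R) x 1) (is_derive1_powR s x0))).
      by rewrite add0r.
    apply: (is_derive_eq (is_deriveN (@is_deriveV _ (fun y : R => 1 + y `^ s) x _ 1 (lt0r_neq0 (p1 x)) h))).
    by rewrite scaleNr opprK [LHS]mulrC.
  - move=> x x0; apply: cvgM.
      by apply: cvgM; [exact: cvg_cst|exact: continuous_powR_gt0].
    apply: cvgV; first by rewrite expf_neq0// gt_eqF.
    rewrite /= -/(GRing.exp _ _).
    have h : 1 + y `^ s @[y --> x] --> 1 + x `^ s.
      by apply: cvgD; [exact: cvg_cst|exact: continuous_powR_gt0].
    by under eq_fun do rewrite expr2; rewrite expr2; exact: cvgM.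
  - by move=> x x0; rewrite divr_ge0 ?mulr_ge0 ?powR_ge0 ?sqr_ge0 ?ltW.
  - move=> x _; rewrite normrN ger0_norm; last by rewrite invr_ge0 ltW.
    rewrite invf_le1//; by rewrite lerDl powR_ge0.
pose C := (1 + 2 * K1 + K2) / s.
apply: (le_integrable _ _ _ (integrableZl _ C ig)) => //.
  apply/measurable_EFinP/measurable_funTS/measurable_funM.
    exact: measurable_powR.
  apply: measurableT_comp => //; apply: measurableT_comp => //.
  by apply: measurable_funM => //; exact: measurable_powR.
move=> x; rewrite /= in_itv/= andbT => x0; rewrite lee_fin.
have x1 : 0 <= x `^ (s - 1) by exact: powR_ge0.
have E0 : 0 < expR (de * x `^ be) by exact: expR_gt0.
rewrite ger0_norm; last by rewrite mulr_ge0// expR_ge0.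
apply: le_trans (ler_norm _); rewrite expRN /C /g.
have -> : (1 + 2 * K1 + K2) / s * (s * x `^ (s - 1) / (1 + x `^ s) ^+ 2) =
   x `^ (s - 1) * ((1 + 2 * K1 + K2) / (1 + x `^ s) ^+ 2).
  by field; rewrite !gt_eqF.
rewrite ler_wpM2l// ler_pdivlMr ?exprn_gt0// mulrC ler_pdivrMr//.
have e1 : 1 <= expR (de * x `^ be).
  by rewrite -expR0 ler_expR mulr_ge0 ?powR_ge0// ltW.
have := hK1 x x0; have := hK2 x x0.
rewrite (powRD (x := x)) ?(gt_eqF (addr_gt0 s0 s0))//.
rewrite expr2; nra.
Qed.

End gg_integrals.

Section rotation.
Context (R : realType).
Local Notation mu := (@lebesgue_measure R).
Local Notation D := (`]0, +oo[%classic : set R).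

Lemma is_derive_expRN_cos (p q : R -> R) (x dp dq : R) :
  is_derive x 1 p dp -> is_derive x 1 q dq ->
  is_derive x 1 (fun y => expR (- p y) * cos (q y))
    (expR (- p x) * (- dp * cos (q x) - dq * sin (q x))).
Proof.
move=> hp hq.
have hE := @is_derive1_comp R expR (- p) x _ _ (is_derive_expR (- p x)) (is_deriveN hp).
have hC := @is_derive1_comp R cos q x _ _ (is_derive_cos (q x)) hq.
apply: (is_derive_eq (is_deriveM hE hC)).
rewrite /GRing.scale/=; ring.
Qed.

Lemma is_derive_expRN_sin (p q : R -> R) (x dp dq : R) :
  is_derive x 1 p dp -> is_derive x 1 q dq ->
  is_derive x 1 (fun y => expR (- p y) * sin (q y))
    (expR (- p x) * (- dp * sin (q x) + dq * cos (q x))).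
Proof.
move=> hp hq.
have hE := @is_derive1_comp R expR (- p) x _ _ (is_derive_expR (- p x)) (is_deriveN hp).
have hC := @is_derive1_comp R sin q x _ _ (is_derive_sin (q x)) hq.
apply: (is_derive_eq (is_deriveM hE hC)).
rewrite /GRing.scale/=; ring.
Qed.

Variables (s a be phi : R).
Hypotheses (s0 : 0 < s) (a0 : 0 < a) (be0 : 0 < be).

(** [f] is the real part of [x `^ (s - 1)] times the exponential of
    [- a * exp (- 'i * psi) * x `^ be], times the phase [phi - s / be * psi]
    that compensates the rotation.  Its derivative [h] in [psi] is also the
    derivative of [G] in [x]: this is Cauchy's theorem on a sector, in real
    terms. *)
Let th (psi x : R) := a * sin psi * x `^ be + (phi - s / be * psi).
Let E (psi x : R) := expR (- (a * cos psi * x `^ be)).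
Let f (psi x : R) := x `^ (s - 1) * (E psi x * cos (th psi x)).
Let G (psi x : R) := be^-1 * (x `^ s * (E psi x * sin (th psi x))).
Let h (psi x : R) := x `^ (s - 1) * (E psi x *
  (a * x `^ be * (sin psi * cos (th psi x) - cos psi * sin (th psi x)) +
   s / be * sin (th psi x))).

Let dpsi (psi x : R) : is_derive psi 1 (f ^~ x) (h psi x).
Proof.
have hp : is_derive psi 1 (fun y => a * cos y * x `^ be) (- (a * sin psi * x `^ be)).
  rewrite (_ : (fun y => _) = (a * x `^ be) \*: (cos : R -> R)); last first.
    by apply/funext => y /=; rewrite /GRing.scale/=; ring.
  apply: (is_derive_eq (is_deriveZ (a * x `^ be) (is_derive_cos psi))).
  by rewrite /GRing.scale/=; ring.
have hq : is_derive psi 1 (fun y => th y x) (a * cos psi * x `^ be - s / be).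
  rewrite (_ : (fun y => _) = (a * x `^ be) \*: (sin : R -> R) +
      (cst phi - (s / be) \*: (id : R -> R))); last first.
    apply/funext => y; rewrite /th !fctE.
    by rewrite -[X in _ = X + _]/(a * x `^ be * sin y) -[X in _ = _ + (_ - X)]/(s / be * y); ring.
  have h1 := is_deriveZ (a * x `^ be) (is_derive_sin psi).
  have h2 := is_deriveB (is_derive_cst (phi : R) psi 1)
    (is_deriveZ (s / be) (is_derive_id psi 1)).
  apply: (is_derive_eq (is_deriveD h1 h2)).
  by rewrite /GRing.scale/=; ring.
apply: (is_derive_eq (is_deriveZ (x `^ (s - 1)) (is_derive_expRN_cos hp hq))).
by rewrite /h /E /GRing.scale/=; ring.
Qed.

Let dx (psi x : R) : 0 < x -> is_derive x 1 (G psi) (h psi x).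
Proof.
move=> x0; have hb := is_derive1_powR be x0; have hs := is_derive1_powR s x0.
have hp : is_derive x 1 (fun y => a * cos psi * y `^ be)
    (a * cos psi * (be * x `^ (be - 1))) := is_deriveZ (a * cos psi) hb.
have hq : is_derive x 1 (th psi) (a * sin psi * (be * x `^ (be - 1))).
  apply: (is_derive_eq (is_deriveD (is_deriveZ (a * sin psi) hb)
    (is_derive_cst (phi - s / be * psi) x 1))).
  by rewrite addr0.
have := is_deriveZ be^-1 (is_deriveM hs (is_derive_expRN_sin hp hq)).
move/is_derive_eq; apply.
rewrite /h -/(E psi x) /GRing.scale/=.
rewrite -{1}(mulr_powRB1 (ltW x0) s0) -[in RHS](mulr_powRB1 (ltW x0) be0).
by field; rewrite gt_eqF.
Qed.

(** A bound for [h psi] that serves for all [psi] with [c <= cos psi], so that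
    the integral of [f psi] may be differentiated in [psi]. *)
Let dom (c x : R) := a * (x `^ (s + be - 1) * expR (- (a * c * x `^ be))) +
  s / be * (x `^ (s - 1) * expR (- (a * c * x `^ be))).

Let integrable_dom c : 0 < c -> mu.-integrable D (EFin \o dom c).
Proof.
move=> c0; have ac0 : 0 < a * c by exact: mulr_gt0.
have i1 := integrable_powR_expR (addr_gt0 s0 be0) ac0 be0.
have i2 := integrable_powR_expR s0 ac0 be0.
have mD : measurable (D : set (measurableTypeR R)) by exact: measurable_itv.
have H := integrableD mD (integrableZl mD a i1) (integrableZl mD (s / be) i2).
apply: (eq_integrable mD _ _ _ H) => x _; by rewrite /dom/= EFinD !EFinM.
Qed.

Let E_le c psi x : c <= cos psi -> E psi x <= expR (- (a * c * x `^ be)).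
Proof.
by move=> ?; rewrite /E ler_expR lerN2 ler_wpM2r ?powR_ge0// ler_wpM2l// ltW.
Qed.

Let h_dom c psi x : 0 < x -> c <= cos psi -> `|h psi x| <= dom c x.
Proof.
move=> x0 cpsi; have El := E_le x cpsi.
rewrite /h /dom normrM ger0_norm ?powR_ge0// normrM ger0_norm ?expR_ge0//.
have xE : x `^ (s + be - 1) = x `^ (s - 1) * x `^ be.
  rewrite (_ : s + be - 1 = s - 1 + be); last by ring.
  by rewrite powRD ?(lt0r_neq0 x0) ?implybT.
rewrite xE.
set u := x `^ (s - 1); set v := x `^ be; set e := expR _.
have u0 : 0 <= u by exact: powR_ge0.
have v0 : 0 <= v by exact: powR_ge0.
set z := `|_|; have z0 : 0 <= z by exact: normr_ge0.
have zle : z <= a * v + s / be.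
  apply: (le_trans (ler_normD _ _)); apply: lerD.
    have av0 : 0 <= a * v by rewrite mulr_ge0// ltW.
    by rewrite normrM ger0_norm// ler_piMr// -sinB sin_max.
  have sb0 : 0 <= s / be by rewrite divr_ge0// ltW.
  by rewrite normrM ger0_norm// ler_piMr// sin_max.
have -> : a * (u * v * e) + s / be * (u * e) = u * (e * (a * v + s / be)).
  by ring.
by rewrite ler_wpM2l// ler_pM// expR_ge0.
Qed.

Let G_le c psi x : c <= cos psi ->
  `|G psi x| <= be^-1 * (x `^ s * expR (- (a * c * x `^ be))).
Proof.
move=> cpsi; have be0' : 0 <= be^-1 by rewrite invr_ge0 ltW.
rewrite /G normrM ger0_norm// ler_wpM2l// normrM ger0_norm ?powR_ge0//.
rewrite ler_wpM2l ?powR_ge0// normrM ger0_norm ?expR_ge0//.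
rewrite -[leRHS]mulr1; apply: ler_pM; rewrite ?expR_ge0 ?normr_ge0//.
  exact: E_le.
exact: sin_max.
Qed.

Let continuous_h psi x : 0 < x -> {for x, continuous (h psi)}.
Proof.
move=> x0; have hb := is_derive1_powR be x0; have hs := is_derive1_powR (s - 1) x0.
have hp : is_derive x 1 (fun y => a * cos psi * y `^ be)
    (a * cos psi * (be * x `^ (be - 1))) := is_deriveZ (a * cos psi) hb.
have hq : is_derive x 1 (th psi) (a * sin psi * (be * x `^ (be - 1))).
  apply: (is_derive_eq (is_deriveD (is_deriveZ (a * sin psi) hb)
    (is_derive_cst (phi - s / be * psi) x 1))).
  by rewrite addr0.
have hC := is_derive_expRN_cos hp hq; have hS := is_derive_expRN_sin hp hq.
have hZ (k : R) F dF (hF : is_derive x 1 F dF) :=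
  is_deriveM (is_derive_cst (k : R) x 1) hF.
have H := is_deriveM hs (is_deriveD (is_deriveM (hZ a _ _ hb)
  (is_deriveB (hZ (sin psi) _ _ hC) (hZ (cos psi) _ _ hS))) (hZ (s / be) _ _ hS)).
have -> : h psi = (powR (R:=R))^~ (s - 1) *
  ((cst a * (powR (R:=R))^~ be) *
   (cst (sin psi) * (fun y => expR (- (a * cos psi * y `^ be)) * cos (th psi y)) -
    cst (cos psi) * (fun y => expR (- (a * cos psi * y `^ be)) * sin (th psi y))) +
   cst (s / be) * (fun y => expR (- (a * cos psi * y `^ be)) * sin (th psi y))).
  by apply/funext => y; rewrite /h /E !fctE; ring.
apply/differentiable_continuous/derivable1_diffP.
exact: (@ex_derive _ _ _ _ _ _ _ H).
Qed.

(** The boundary values of [G] at [0] and at infinity vanish. *)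
Let integral_h psi : 0 < cos psi -> \int[mu]_(x in D) h psi x = 0.
Proof.
move=> c0; suff -> : \int[mu]_(x in D) h psi x = 0 - 0 by rewrite subrr.
have ac0 : 0 < a * cos psi by exact: mulr_gt0.
have mh : measurable_fun D (h psi).
  apply: open_continuous_measurable_fun; first exact: interval_open.
  by move=> x; rewrite inE/= in_itv/= andbT; exact: continuous_h.
apply: (FTC_half_line (G := G psi)).
- by move=> x x0; exact: dx.
- by move=> x x0; exact: continuous_h.
- apply: (le_integrable _ _ _ (integrable_dom c0)) => //.
    exact/measurable_EFinP.
  move=> x; rewrite /= in_itv/= andbT => x0; rewrite lee_fin.
  exact: le_trans (h_dom x0 (lexx _)) (ler_norm _).
- apply: norm_cvg0.
  apply: (@squeeze_cvgr _ _ _ _ (cst 0) (fun x => be^-1 * x `^ s)).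
  + near=> x; rewrite normr_ge0/= (le_trans (G_le x (lexx _)))//.
    rewrite /= ler_wpM2l ?invr_ge0 ?(ltW be0)// ler_piMr ?powR_ge0//.
    by rewrite -expR0 ler_expR oppr_le0 mulr_ge0 ?powR_ge0// ltW.
  + exact: cvg_cst.
  + by rewrite -[X in _ --> X](mulr0 be^-1); apply: cvgZr; exact: powR_cvg0.
- have [K K0 hK] := powR_le_expR (addr_ge0 (ltW s0) ler01) ac0 be0.
  apply: norm_cvg0.
  apply: (@squeeze_cvgr _ _ _ _ (cst 0) (fun x => be^-1 * K * x^-1)).
  + near=> x; have x0 : 0 < x by near: x; exact: nbhs_pinfty_gt.
    rewrite normr_ge0/= (le_trans (G_le x (lexx _)))//=.
    rewrite -(mulrA be^-1 K) ler_wpM2l ?invr_ge0 ?(ltW be0)// expRN ler_pdivrMr ?expR_gt0//.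
    rewrite mulrAC ler_pdivlMr//.
    have := hK x x0; rewrite powRD ?(lt0r_neq0 x0) ?implybT//.
    by rewrite powRr1// ltW.
  + exact: cvg_cst.
  + rewrite -[X in _ --> X](mulr0 (be^-1 * K)); apply: cvgZr.
    apply/cvgr0Pnorm_le => e e0; near=> x.
    have x0 : 0 < x by near: x; exact: nbhs_pinfty_gt.
    have xe : e^-1 <= x by near: x; exact/nbhs_pinfty_ge/num_real.
    by rewrite ger0_norm ?invr_ge0 ?(ltW x0)// -[leRHS]invrK lef_pV2 ?posrE ?invr_gt0.
Unshelve. all: by end_near. Qed.

Let mE psi : measurable_fun setT (E psi).
Proof.
apply: measurableT_comp => //; apply: measurableT_comp => //.
by apply: measurable_funM => //; exact: measurable_powR.
Qed.

Let mf psi : measurable_fun setT (f psi).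
Proof.
apply: measurable_funM; first exact: measurable_powR.
apply: measurable_funM; first exact: mE.
apply: measurable_cosT; apply: measurable_funD => //.
by apply: measurable_funM => //; exact: measurable_powR.
Qed.

Let integrable_f psi : 0 < cos psi -> mu.-integrable D (EFin \o f psi).
Proof.
move=> c0; have ac0 : 0 < a * cos psi by exact: mulr_gt0.
have i2 := integrable_powR_expR s0 ac0 be0.
apply: (le_integrable _ _ _ i2) => //.
  apply/measurable_EFinP/measurable_funTS; exact: mf.
move=> x _; rewrite lee_fin /f normrM (ger0_norm (powR_ge0 _ _)).
apply: le_trans (ler_norm _); rewrite ler_wpM2l ?powR_ge0//.
by rewrite normrM ger0_norm ?expR_ge0// ler_piMr ?expR_ge0// cos_max.
Qed.

(** The derivative in [psi] of the left-hand side is the integral of [h], which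
    is zero; at [psi = 0] both sides are equal. *)
Lemma rotation_integral (psi : R) : 0 <= psi < pi / 2 ->
  \int[mu]_(x in D) (x `^ (s - 1) * (expR (- (a * cos psi * x `^ be)) *
     cos (a * sin psi * x `^ be + (phi - s / be * psi)))) =
  cos phi * \int[mu]_(x in D) (x `^ (s - 1) * expR (- (a * x `^ be))).
Proof.
move=> /andP[psi0 psi1].
(* The derivative is dominated uniformly on the open interval from [- r] to
   [r], which contains the closed one from [0] to [psi]. *)
pose r := (psi + pi / 2) / 2.
have pr : psi < r by rewrite /r; lra.
have rp : r < pi / 2 by rewrite /r; lra.
have cr : 0 < cos r by apply: cos_gt0_pihalf; lra.
have c_ge y : -r < y < r -> cos r <= cos y.
  move=> /andP[y1 y2]; wlog y0 : y y1 y2 / 0 <= y => [hw|].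
    have [/hw//|/ltW y0] := leP 0 y; first exact.
    by rewrite -(cosN y); apply: hw; lra.
  by rewrite leNgt ltr_cos ?in_itv/=; [rewrite -leNgt ltW|lra|lra].
have c_gt y : -r < y < r -> 0 < cos y by move=> /c_ge; exact: lt_le_trans.
pose F y := \int[mu]_(x in D) f y x.
have fd y x : derivable (f ^~ x) y 1.
  exact: (@ex_derive _ _ _ _ _ _ _ (dpsi y x)).
have d1E y x : partial1of2 f y x = h y x.
  by rewrite partial1of2E (@derive_val _ _ _ _ _ _ _ (dpsi y x)).
have DF y : -r < y < r -> is_derive y 1 F 0.
  move=> yr.
  have Iy : (`]- r, r[%classic : set R) y by rewrite /= in_itv.
  have Hint x : (`]- r, r[%classic : set R) x -> mu.-integrable D (EFin \o f x).
    by rewrite /= in_itv/= => /c_gt; exact: integrable_f.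
  have dom0 x : 0 <= dom (cos r) x.
    have sb0 : 0 <= s / be by rewrite divr_ge0// ltW.
    have e0 z : 0 <= x `^ z * expR (- (a * cos r * x `^ be)).
      by rewrite mulr_ge0 ?powR_ge0 ?expR_ge0.
    by apply: addr_ge0; apply: mulr_ge0 => //; exact: ltW.
  have Hdom x z : (`]- r, r[%classic : set R) x -> D z ->
      `|partial1of2 f x z| <= dom (cos r) z.
    rewrite /= !in_itv/= andbT => /c_ge xr z0; rewrite d1E; exact: h_dom.
  have mD : measurable (D : set (measurableTypeR R)) by exact: measurable_itv.
  have fd' x z : (`]- r, r[%classic : set R) x -> D z -> derivable (f ^~ z) x 1.
    by move=> _ _; exact: fd.
  apply: DeriveDef.
    exact: (derivable_under_integral mD Iy Hint fd' dom0 (integrable_dom cr) Hdom).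
  rewrite -derive1E.
  rewrite (differentiation_under_integral mD Iy Hint fd' dom0 (integrable_dom cr) Hdom)//.
  transitivity (\int[mu]_(x in D) h y x); last exact: (integral_h (c_gt y yr)).
  by apply: eq_Rintegral => x _; exact: d1E.
have -> : \int[mu]_(x in D) (x `^ (s - 1) * (expR (- (a * cos psi * x `^ be)) *
     cos (a * sin psi * x `^ be + (phi - s / be * psi)))) = F psi by [].
have -> : F psi = F 0.
  move: psi0; rewrite le_eqVlt => /predU1P[<-//|psi0].
  have F0 y : y \in `]0, psi[ -> is_derive y 1 F ((cst 0 : R -> R) y).
    by rewrite in_itv/= => /andP[y0 y1]; apply: DF; lra.
  have cF : {within `[0, psi], continuous F}.
    apply: continuous_in_subspaceT => y; rewrite inE/= in_itv/= => /andP[y0 y1].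
    apply/differentiable_continuous/derivable1_diffP.
    by apply: (@ex_derive _ _ _ _ _ _ _ (DF y _)); lra.
  have [c _] := MVT psi0 F0 cF.
  by rewrite /cst mul0r => /eqP; rewrite subr_eq0 => /eqP.
rewrite /F -RintegralZl//.
  apply: eq_Rintegral => x _.
  by rewrite /f /E /th cos0 sin0 mulr1 mulr0 mul0r add0r mulr0 subr0; ring.
exact: integrable_powR_expR.
Qed.

End rotation.

(** * Expectations under a generalized gamma law *)

Lemma powR_expR_integral_gt0 (R : realType) (s de be : R) :
  0 < s -> 0 < de -> 0 < be ->
  0 < \int[@lebesgue_measure R]_(x in `]0, +oo[)
        (x `^ (s - 1) * expR (- (de * x `^ be))).
Proof.
move=> s0 de0 be0; have ig := integrable_powR_expR s0 de0 be0.
pose g (x : R) := x `^ (s - 1) * expR (- (de * x `^ be)).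
change (0 < \int[@lebesgue_measure R]_(x in `]0, +oo[) g x).
have g0 x : 0 < x -> 0 < g x by move=> x0; rewrite mulr_gt0 ?powR_gt0 ?expR_gt0.
have Dg0 (x : R) : x \in `]0, +oo[%classic -> 0 < x.
  by rewrite inE/= in_itv/= andbT.
rewrite lt_neqAle Rintegral_ge0 ?andbT; last first.
  by move=> x /mem_set/Dg0 x0; rewrite ltW// g0.
apply/eqP => /esym J0.
have mD : measurable (`]0, +oo[%classic : set (measurableTypeR R)) by exact: measurable_itv.
have E : (\int[@lebesgue_measure R]_(x in `]0%R, +oo[%classic) `|(g x)%:E| = 0)%E.
  transitivity (\int[@lebesgue_measure R]_(x in `]0%R, +oo[%classic) (g x)%:E)%E.
    by apply: eq_integral => x /Dg0 x0; rewrite gee0_abs// lee_fin ltW// g0.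
  rewrite -[LHS]fineK; last exact: (integrable_fin_num mD ig).
  by congr EFin; exact: J0.
have /integrableP[mg _] := ig.
have [N [mN N0 sN]] := (ae_eq_integral_abs _ mD mg).1 E.
have DN : `]0, +oo[%classic `<=` N.
  apply: subset_trans sN => x Dx /= h; have := h Dx.
  by case=> gx; have := g0 x (Dg0 _ (mem_set Dx)); rewrite /g gx ltxx.
have Dy : @lebesgue_measure R `]0%R, +oo[%classic = +oo%E.
  by rewrite lebesgue_measure_itv/= ltry.
have := le_measure (@lebesgue_measure R) (mem_set mD) (mem_set mN) DN.
by rewrite [X in (_ <= X)%E -> _]N0 [X in (X <= _)%E -> _]Dy leye_eq.
Qed.

Section GG_expectation.
Context (R : realType) d (T : measurableType d) (P : probability T R).
Variables (al be ga : R) (xi : {RV P >-> R}).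
Hypotheses (al0 : 0 < al) (be0 : 0 < be) (ga0 : 0 < ga).
Hypothesis hxi : is_GG al be ga xi.
Local Notation mu := (@lebesgue_measure R).
Local Notation D := (`]0, +oo[%classic : set R).

Let w (x : R) := x `^ (ga - 1) * expR (- (al * x `^ be)).
Let k := be * al `^ (ga / be) / Gamma (ga / be).

Let k0 : 0 <= k.
Proof.
rewrite /k divr_ge0//; first by rewrite mulr_ge0 ?powR_ge0// ltW.
by apply: Rintegral_ge0 => x _; rewrite mulr_ge0 ?powR_ge0 ?expR_ge0.
Qed.

Let w0 x : 0 <= w x.
Proof. by rewrite mulr_ge0 ?powR_ge0 ?expR_ge0. Qed.

Let mw : measurable_fun setT w.
Proof.
apply: measurable_funM; first exact: measurable_powR.
apply: measurableT_comp => //; apply: measurableT_comp => //.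
by apply: measurable_funM => //; exact: measurable_powR.
Qed.

Let pdfE : gg_pdf al be ga = (fun x => k * w x) \_ `[0, +oo[.
Proof. by rewrite /gg_pdf; congr patch; apply/funext => x; rewrite /k/w mulrA. Qed.

Let mpdf : measurable_fun setT (gg_pdf al be ga).
Proof.
rewrite pdfE; apply/(measurable_restrictT _ _).1; first exact: measurable_itv.
by apply/measurable_funTS/measurable_funM.
Qed.

Let pdf0 x : 0 <= gg_pdf al be ga x.
Proof. by rewrite pdfE patchE; case: ifP => // _; rewrite mulr_ge0. Qed.

(* Lebesgue measure is carried by another measurable structure on [R]; [xi] is
   retyped so that its law and Lebesgue measure can be compared. *)
Let xi_copy : T -> measurableTypeR R := xi.

Let mxi_copy : measurable_fun setT xi_copy.
Proof. exact: (@measurable_funPT _ _ _ _ xi). Qed.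

Let xi' : {mfun T >-> measurableTypeR R} :=
  HB.pack xi_copy (isMeasurableFun.Build _ _ _ _ xi_copy mxi_copy).

Let ge0_GG (f : R -> R) : measurable_fun setT f -> (forall x, 0 <= f x) ->
  (\int[P]_t (f (xi t))%:E = k%:E * \int[mu]_(x in D) (f x * w x)%:E)%E.
Proof.
move=> mf f0.
have mf' : measurable_fun setT (EFin \o f) by exact/measurable_EFinP.
transitivity (\int[distribution P xi']_x (f x)%:E)%E.
  by rewrite ge0_integral_distribution// => x; rewrite lee_fin.
rewrite (@ge0_integral_density _ _ _ mu _ (gg_pdf al be ga))//.
have mfw : measurable_fun setT (fun x => (f x * w x)%:E).
  exact/measurable_EFinP/measurable_funM.
rewrite integral_itv_obnd_cbnd; last exact: measurable_funTS.
rewrite -ge0_integralZl//; last 2 first.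
- exact: measurable_funTS.
- by move=> x _; rewrite lee_fin mulr_ge0.
rewrite [RHS]integral_mkcond; apply: eq_integral => x _.
rewrite pdfE !patchE; case: ifP => _; last by rewrite mule0.
by rewrite -!EFinM mulrCA.
Qed.

(** As [P] has total mass [1], the normalising constant is not zero; the Gamma
    integral need not be evaluated. *)
Let k_neq0 : k != 0.
Proof.
apply/eqP => k00.
have E0 := ge0_GG (f := cst 1) (measurable_cst _) (fun=> ler01).
have E1 := @integral_cst _ _ _ P setT measurableT 1%E.
rewrite k00 mul0e in E0; move: E1; rewrite [LHS]E0 mul1e => E1.
by have /eqP := etrans E1 (probability_setT P); rewrite eq_sym onee_eq0.
Qed.

Let k_gt0 : 0 < k. Proof. by rewrite lt_neqAle eq_sym k_neq0. Qed.

Lemma GG_integral (f : R -> R) : measurable_fun setT f ->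
  mu.-integrable D (fun x => (f x * w x)%:E) ->
  P.-integrable setT (fun t => (f (xi t))%:E) /\
  \int[P]_t f (xi t) = k * \int[mu]_(x in D) (f x * w x).
Proof.
move=> mf fi.
have int (g : R -> R) : measurable_fun setT g -> (forall x, `|g x| <= `|f x|) ->
    mu.-integrable D (fun x => (g x * w x)%:E) /\
    P.-integrable setT (fun t => (g (xi t))%:E).
  move=> mg gf.
  have ig : mu.-integrable D (fun x => (g x * w x)%:E).
    apply: (le_integrable _ _ _ fi) => //.
      exact/measurable_funTS/measurable_EFinP/measurable_funM.
    by move=> x _; rewrite lee_fin !normrM ler_wpM2r.
  split=> //; apply/integrableP; split.
    by apply/measurable_EFinP; exact: (measurableT_comp mg).
  rewrite (ge0_GG (f := fun x => `|g x|))//; last exact: measurableT_comp.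
  rewrite lte_mul_pinfty ?lee_fin//.
  have /integrableP[_] := ig; congr (_ < _)%E; apply: eq_integral => x _.
  by rewrite abse_EFin normrM (ger0_norm (w0 x)).
have ge0E (g : R -> R) : measurable_fun setT g -> (forall x, `|g x| <= `|f x|) ->
    (forall x, 0 <= g x) -> \int[P]_t g (xi t) = k * \int[mu]_(x in D) (g x * w x).
  move=> mg gf g0; rewrite /Rintegral ge0_GG// fineM//.
  by apply: integrable_fin_num => //; have [] := int g mg gf.
have [_ iP] := int f mf (fun x => lexx _); split => //.
have fpE x : f x = f^\+ x - f^\- x by rewrite -[in LHS](funrposBneg f).
have mp := measurable_funrpos mf; have mn := measurable_funrneg mf.
have pf x : `|f^\+ x| <= `|f x|.
  by rewrite ger0_norm ?funrpos_ge0// -[leRHS]/((Num.norm \o f) x) -funrposDneg lerDl funrneg_ge0.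
have nf x : `|f^\- x| <= `|f x|.
  by rewrite ger0_norm ?funrneg_ge0// -[leRHS]/((Num.norm \o f) x) -funrposDneg lerDr funrpos_ge0.
have [ip1 ip2] := int _ mp pf; have [in1 in2] := int _ mn nf.
transitivity (\int[P]_t (f^\+ (xi t) - f^\- (xi t))).
  by apply: eq_Rintegral => t _; exact: fpE.
have p0 x : 0 <= f^\+ x by exact: funrpos_ge0.
have n0 x : 0 <= f^\- x by exact: funrneg_ge0.
rewrite RintegralB// (ge0E _ mp pf p0) (ge0E _ mn nf n0).
rewrite -mulrBr -RintegralB//; congr (_ * _).
by apply: eq_Rintegral => x _; rewrite -mulrBl -fpE.
Qed.

Lemma GG_ae_ge0 : {ae P, forall t, 0 <= xi t}.
Proof.
exists (xi @^-1` `]-oo, 0[); split.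
- by rewrite -[X in measurable X]setTI; exact: measurable_funP.
- rewrite -[LHS]/(distribution P xi _) hxi//.
  apply: integral0_eq => x; rewrite /= in_itv/= => x0.
  by rewrite pdfE patchE memNset//= in_itv/= andbT; apply/negP; rewrite -ltNge.
- by move=> t /= /negP; rewrite -ltNge in_itv.
Qed.

Let wM (f : R -> R) r x : (forall y, 0 < y -> f y = y `^ r) -> 0 < x ->
  f x * w x = x `^ (ga + r - 1) * expR (- (al * x `^ be)).
Proof.
move=> fr x0; rewrite fr// /w mulrA -powRD ?(lt0r_neq0 x0) ?implybT//.
by congr (_ `^ _ * _); ring.
Qed.

Lemma GG_power_integrable (f : R -> R) (r : R) : 0 < ga + r ->
  measurable_fun setT f -> (forall x, 0 < x -> f x = x `^ r) ->
  mu.-integrable D (fun x => (f x * w x)%:E).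
Proof.
move=> gr mf fr.
apply: (eq_integrable _ _ _ _ (integrable_powR_expR gr al0 be0)) => //.
by move=> x; rewrite inE/= in_itv/= andbT => x0; rewrite (wM fr x0).
Qed.

Lemma GG_integrable_power (f : R -> R) (r : R) : 0 < ga + r ->
  measurable_fun setT f -> (forall x, 0 < x -> f x = x `^ r) ->
  P.-integrable setT (fun t => (f (xi t))%:E).
Proof. by move=> gr mf fr; have [] := GG_integral mf (GG_power_integrable gr mf fr). Qed.

(** This is [rotation_integral] for [a = al / cos psi], which gives the decay rate
    [al] and the frequency [al * tan psi].  The constant serves for all phases,
    so for the sine and the cosine alike.  Only the values of [f] on the positive
    reals matter, which allows [f] to be any convenient extension of a power. *)
Lemma GG_trig (psi r : R) : 0 <= psi < pi / 2 -> 0 < ga + r ->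
  exists2 C : R, 0 < C & forall (f : R -> R) (phi : R), measurable_fun setT f ->
    (forall x, 0 < x -> f x = x `^ r) ->
    P.-integrable setT
      (fun t => (f (xi t) * cos (al * tan psi * xi t `^ be + phi))%:E) /\
    \int[P]_t (f (xi t) * cos (al * tan psi * xi t `^ be + phi)) =
      C * cos ((ga + r) / be * psi + phi).
Proof.
move=> /[dup] psi01 /andP[psi0 psi1] gr.
have c0 : 0 < cos psi by apply: cos_gt0_pihalf; lra.
pose a := al / cos psi; have a0 : 0 < a by rewrite divr_gt0.
have aE : a * cos psi = al by rewrite /a divfK// gt_eqF.
have asE : a * sin psi = al * tan psi by rewrite /a /tan mulrAC mulrA.
pose J := \int[mu]_(x in D) (x `^ (ga + r - 1) * expR (- (a * x `^ be))).
have J0 : 0 < J by exact: powR_expR_integral_gt0.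
exists (k * J); first exact: mulr_gt0.
move=> f phi mf fr.
have mc : measurable_fun setT (fun x => f x * cos (al * tan psi * x `^ be + phi)).
  apply: measurable_funM => //; apply: measurable_cosT; apply: measurable_funD => //.
  by apply: measurable_funM => //; exact: measurable_powR.
have ic : mu.-integrable D (fun x => (f x * cos (al * tan psi * x `^ be + phi) * w x)%:E).
  apply: (le_integrable _ _ _ (GG_power_integrable gr mf fr)) => //.
    exact/measurable_funTS/measurable_EFinP/measurable_funM.
  move=> x _; rewrite lee_fin mulrAC [leLHS]normrM ler_piMr//; exact: cos_max.
have [iP ->] := GG_integral mc ic; split => //.
rewrite -mulrA; congr (_ * _).
have := rotation_integral ((ga + r) / be * psi + phi) gr a0 be0 psi01.
rewrite aE asE -/J => E; rewrite [RHS]mulrC -E.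
apply: eq_Rintegral => x; rewrite inE/= in_itv/= andbT => x0.
rewrite mulrAC (wM fr x0) mulrA; congr (_ * cos _).
by ring.
Qed.

(** As [n / 2 <= be], the power [x ^+ (n * j)] is at most a multiple of
    [(2 * j)! / de ^ (2 * j)] times [expR (de * x ^ be)], which is integrable
    under the law for [de < al]. *)
Lemma GG_moment_le (n : nat) : n%:R <= 2 * be -> exists C b : R,
  [/\ 0 <= C, 0 < b & forall j,
    \int[P]_t (`|xi t| ^+ (n * j)) <= C * b ^+ (2 * j) * (2 * j)`!%:R].
Proof.
move=> nbe; pose de := al / 2.
have de0 : 0 < de by rewrite divr_gt0.
pose J := \int[mu]_(x in D) (x `^ (ga - 1) * expR (- (de * x `^ be))).
have J0 : 0 <= J.
  by apply: Rintegral_ge0 => x _; rewrite mulr_ge0 ?powR_ge0 ?expR_ge0.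
exists (k * (expR de * J)), de^-1; split.
- by rewrite mulr_ge0// mulr_ge0 ?expR_ge0.
- by rewrite invr_gt0.
move=> j; have mX : measurable_fun setT (fun x : R => `|x| ^+ (n * j)).
  by apply: measurable_funX; exact: normr_measurable.
have ganj : 0 < ga + (n * j)%:R by rewrite ltr_wpDr.
have Xpow (x : R) : 0 < x -> `|x| ^+ (n * j) = x `^ (n * j)%:R.
  by move=> x0; rewrite gtr0_norm// powR_mulrn// ltW.
have iX := GG_power_integrable ganj mX Xpow.
have [_ ->] := GG_integral mX iX.
have -> : k * (expR de * J) * de^-1 ^+ (2 * j) * (2 * j)`!%:R =
    k * (((2 * j)`!%:R * de^-1 ^+ (2 * j) * expR de) * J) by ring.
have mD : measurable (D : set (measurableTypeR R)) by exact: measurable_itv.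
rewrite ler_wpM2l// -RintegralZl//; last exact: integrable_powR_expR.
apply: le_Rintegral => //.
  exact: (integrableZl mD ((2 * j)`!%:R * de^-1 ^+ (2 * j) * expR de)
    (integrable_powR_expR ga0 de0 be0)).
move=> x; rewrite /= in_itv/= andbT => x0.
have xg0 : 0 <= x `^ (ga - 1) by exact: powR_ge0.
rewrite /w mulrCA [leRHS]mulrCA ler_wpM2l//.
(* Half of the exponential decay absorbs the power, the rest gives [J]. *)
rewrite (_ : al * x `^ be = de * x `^ be + de * x `^ be); last by rewrite /de; field.
rewrite opprD expRD mulrA ler_wpM2r ?expR_ge0// expRN ler_pdivrMr ?expR_gt0//.
have xE : x ^+ (n * j) = (x `^ (n%:R / 2)) ^+ (2 * j).
  rewrite -!powR_mulrn ?powR_ge0 ?(ltW x0)// -powRrM; congr (_ `^ _).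
  by rewrite !natrM; field.
rewrite gtr0_norm// xE; set y := x `^ (n%:R / 2); have y0 : 0 <= y by exact: powR_ge0.
have n2 : 0 <= (n%:R / 2 : R) by rewrite divr_ge0.
have yle : y <= 1 + x `^ be.
  have [x1|x1] := leP x 1.
    have : y <= x `^ 0 by apply: ger_powR; rewrite ?x0.
    by rewrite powRr0 => /le_trans; apply; rewrite lerDl powR_ge0.
  have : y <= x `^ be by apply: ler_powR; [exact: ltW|rewrite ler_pdivrMr// mulrC].
  by move=> /le_trans; apply; rewrite lerDr.
have ey : (de * y) ^+ (2 * j) / (2 * j)`!%:R <= expR (de * y).
  case: j {mX ganj Xpow iX xE} => [|j].
    by rewrite muln0 expr0 fact0 divr1 -[leLHS]expR0 ler_expR mulr_ge0// ltW.
  have := @expR_ge1Dxn R (de * y) (2 * j).+1 (mulr_ge0 (ltW de0) y0).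
  rewrite (_ : (2 * j).+2 = 2 * j.+1)%N; last by rewrite mulnS.
  by apply: le_trans; rewrite lerDr.
have dj0 : 0 < de ^+ (2 * j) by exact: exprn_gt0.
have fj0 : 0 < ((2 * j)`!%:R : R) by rewrite ltr0n fact_gt0.
rewrite exprMn ler_pdivrMr// mulrC -ler_pdivlMr// in ey.
apply: (le_trans ey); rewrite exprVn.
rewrite [leRHS](_ : _ = (expR de * expR (de * x `^ be)) * (2 * j)`!%:R / de ^+ (2 * j)); last by ring.
rewrite ler_wpM2r ?invr_ge0 ?(ltW dj0)// ler_wpM2r ?(ltW fj0)//.
rewrite -expRD ler_expR -[X in X + _]mulr1 -mulrDr ler_wpM2l//; exact: ltW.
Qed.

End GG_expectation.

(** * Indeterminacy from a bounded perturbation *)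

Section indeterminacy.
Context (R : realType) d (T : measurableType d) (P : probability T R).
Variables (U : {RV P >-> R}) (g : T -> R).
Hypotheses (mg : measurable_fun setT g) (g1 : forall t, `|g t| <= 1).
Hypothesis admU : stieltjes_admissible U.
Hypothesis orth : forall j, \int[P]_t (U t ^+ j * g t) = 0.

Let m1g : measurable_fun setT (fun t => 1 + g t).
Proof. exact: measurable_funD. Qed.

Let ge0_1g t : 0 <= 1 + g t.
Proof. by have := g1 t; rewrite ler_norml => /andP[]; lra. Qed.

Let kappa : {measure set T -> \bar R} := density_measure P m1g ge0_1g.

Let ig : P.-integrable setT (EFin \o g).
Proof. exact: bounded_prob_integrable g1. Qed.

Let kappaT : kappa setT = 1%E.
Proof.
have i1 : P.-integrable setT (EFin \o (cst 1 : T -> R)).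
  exact: finite_measure_integrable_cst.
rewrite /kappa /= /density_measure.
under eq_integral do rewrite EFinD.
rewrite (integralD measurableT i1 ig) /= integral_cst//.
rewrite [X in (_ * X + _)%E](probability_setT P) mule1.
rewrite -[X in (_ + X)%E]fineK; last exact: integrable_fin_num.
have := orth 0; under eq_Rintegral do rewrite expr0 mul1r.
by rewrite /Rintegral => ->; rewrite adde0.
Qed.

Let tilted : probability T R :=
  HB.pack (density_measure P m1g ge0_1g)
    (Measure_isProbability.Build _ _ _ (density_measure P m1g ge0_1g) kappaT).

Let nu := distribution tilted U.

Let nuE (f : R -> R) : measurable_fun setT f -> (forall x, 0 <= f x) ->
  P.-integrable setT (fun t => (f (U t))%:E) ->
  (\int[nu]_x (f x)%:E = (\int[P]_t f (U t) + \int[P]_t (f (U t) * g t))%:E)%E.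
Proof.
move=> mf f0 fi.
have mfU : measurable_fun setT (f \o U) by exact: measurableT_comp.
have fgi : P.-integrable setT (fun t => (f (U t) * g t)%:E).
  apply: (le_integrable measurableT _ _ fi).
    exact/measurable_EFinP/measurable_funM.
  by move=> t _; rewrite lee_fin normrM ler_piMr.
rewrite ge0_integral_distribution//; last exact/measurable_EFinP.
rewrite (@ge0_integral_density _ _ _ P _ (fun t => 1 + g t))//; last 2 first.
- exact/measurable_EFinP.
- by move=> t; rewrite lee_fin.
under eq_integral do rewrite /= -EFinM mulrDr mulr1 EFinD.
rewrite integralD// EFinD /Rintegral !fineK//; exact: integrable_fin_num.
Qed.

Let U_ge0 : {ae P, forall t, 0 <= U t}.
Proof.
exists (U @^-1` `]-oo, 0[); split.
- by rewrite -[X in measurable X]setTI; exact: measurable_funP.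
- exact: (supported_nonneg_neg admU.1).
- by move=> t /= /negP; rewrite -ltNge in_itv.
Qed.

Let nu_supported : supported_nonneg nu.
Proof.
have nu0 : nu `]-oo, 0[%classic = 0%E.
  rewrite /nu /distribution /pushforward /=.
  rewrite -[LHS]/(\int[P]_(t in U @^-1` `]-oo, 0%R[%classic) (1 + g t)%:E)%E.
  apply: null_set_integral => //.
  - by rewrite -[X in measurable X]setTI; exact: measurable_funP.
  - exact/measurable_EFinP/measurable_funTS.
  - exact: (supported_nonneg_neg admU.1).
rewrite /supported_nonneg -setCitvl probability_setC//.
by rewrite [X in (1 - X)%E]nu0 sube0.
Qed.

(** With [`|x|] in place of [x], moments are integrals of nonnegative functions,
    as [nuE] requires. *)
Let norm_moment (m : probability R R) j : supported_nonneg m ->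
  moment m j = (\int[m]_x (`|x| ^+ j)%:E)%E.
Proof.
move=> h; apply: ae_eq_integral => //.
- by apply/measurable_EFinP; exact: measurable_funX.
- by apply/measurable_EFinP; apply: measurable_funX; exact: normr_measurable.
by apply: filterS (supported_nonneg_ae h) => x x0 _; rewrite ger0_norm.
Qed.

Let integrable_norm_U j : P.-integrable setT (fun t => (`|U t| ^+ j)%:E).
Proof.
apply/integrableP; split.
  by apply/measurable_EFinP; apply: measurable_funX; exact: measurableT_comp.
have /integrableP[_] := admU.2 j.
rewrite ge0_integral_distribution//; last first.
  by apply: measurableT_comp => //; apply/measurable_EFinP; exact: measurable_funX.
by congr (_ < _)%E; apply: eq_integral => t _ /=; rewrite !normrX normr_id.
Qed.

Let nu_moment j : moment nu j = moment (distribution P U) j.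
Proof.
rewrite !norm_moment//; last exact: admU.1.
have mj : measurable_fun setT (fun x : R => `|x| ^+ j).
  by apply: measurable_funX; exact: normr_measurable.
have Z : \int[P]_t (`|U t| ^+ j * g t) = 0.
  rewrite -(orth j) /Rintegral; congr fine; apply: ae_eq_integral => //.
  - apply/measurable_EFinP/measurable_funM => //.
    by apply: measurable_funX; exact: measurableT_comp.
  - by apply/measurable_EFinP/measurable_funM => //; exact: measurable_funX.
  by apply: filterS U_ge0 => t Ut _; rewrite ger0_norm.
rewrite nuE// Z addr0 ge0_integral_distribution//; last exact/measurable_EFinP.
by rewrite /Rintegral fineK//; exact: integrable_fin_num.
Qed.

(** The law [nu] of [U] under the density [1 + g] has the moments of [U], as [g]
    is orthogonal to the powers of [U], but not the same expectation of
    [sqrt `|x|]. *)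
Theorem not_M_det : \int[P]_t (Num.sqrt `|U t| * g t) != 0 -> ~ M_det U.
Proof.
move=> /eqP ne0 [_ /(_ nu nu_supported nu_moment) E]; apply: ne0.
pose q (x : R) := Num.sqrt `|x|.
have mq : measurable_fun setT q.
  apply: measurableT_comp => //; apply: continuous_measurable_fun.
  exact: sqrt_continuous.
have q0 x : 0 <= q x by exact: sqrtr_ge0.
have iq : P.-integrable setT (fun t => (q (U t))%:E).
  have i1 : P.-integrable setT (fun t => (1 + `|U t|)%:E).
    under eq_fun do rewrite EFinD.
    apply: integrableD => //; first exact: finite_measure_integrable_cst.
    exact: (integrable_norm_U 1).
  apply: (le_integrable measurableT _ _ i1).
    by apply/measurable_EFinP; exact: (measurableT_comp mq).
  move=> t _; rewrite lee_fin; apply: le_trans (ler_norm _).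
  rewrite (ger0_norm (q0 _)).
  have : 0 <= (q (U t) - 1) ^+ 2 by exact: sqr_ge0.
  have : q (U t) ^+ 2 = `|U t| by rewrite sqr_sqrtr.
  have := q0 (U t); set z := q _; nra.
have qE : (\int[nu]_x (q x)%:E = \int[distribution P U]_x (q x)%:E)%E.
  by apply: eq_measure_integral => A mA _; exact: E.
move: qE; rewrite nuE// ge0_integral_distribution//; last first.
  exact/measurable_EFinP.
move/(congr1 fine) => /= h.
by apply: (addrI (\int[P]_t q (U t))); rewrite addr0; exact: h.
Qed.

End indeterminacy.

(** * Oscillating moments of a product of independent variables *)

Section trig_product.
Context (R : realType) (I : finType).
Implicit Types (r th : I -> R).

Let cis (x : R) : R[i] := Complex (cos x) (sin x).

Let cisD x y : cis (x + y) = cis x * cis y.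
Proof. by rewrite /cis cosD sinD; congr Complex; rewrite addrC. Qed.

Let cis0 : cis 0 = 1.
Proof. by rewrite /cis cos0 sin0. Qed.

Let cis_sum th : \prod_i cis (th i) = cis (\sum_i th i).
Proof. by rewrite (big_morph cis cisD cis0). Qed.

Let ReD (x y : R[i]) : @complex.Re R (x + y) = @complex.Re R x + @complex.Re R y.
Proof. by case: x y => [a b] [c e]. Qed.

(** Expanding the product of the [r i * (cos (th i) + 'i * sin (th i))] turns the
    cosine of a sum into products with one factor for each [i], to which
    independence applies. *)
Lemma prod_cos_sum_expand r th (phi : R) :
  (\prod_i r i) * cos (\sum_i th i + phi) =
  \sum_(J : {ffun I -> bool}) cos ((\sum_i J i)%:R * (pi / 2) + phi) *
     \prod_i (r i * (if J i then sin (th i) else cos (th i))).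
Proof.
have rC (x : R) (z : R[i]) : @complex.Re R (real_complex R x * z) = x * @complex.Re R z.
  by case: z => [u v] /=; rewrite mul0r subr0.
have -> : (\prod_i r i) * cos (\sum_i th i + phi) =
    @complex.Re R (\prod_i (real_complex R (r i) * cis (th i)) * cis phi).
  by rewrite big_split/= -rmorph_prod -mulrA cis_sum -cisD rC.
have E i : real_complex R (r i) * cis (th i) = \sum_(b : bool)
    real_complex R (r i * (if b then sin (th i) else cos (th i))) * cis (b%:R * (pi / 2)).
  rewrite big_bool/= mul1r mul0r cis0 mulr1 /cis cos_pihalf sin_pihalf.
  by apply/eqP; rewrite eq_complex /=; apply/andP; split; apply/eqP; ring.
under eq_bigr do rewrite E.
rewrite bigA_distr_bigA mulr_suml (big_morph (@complex.Re R) ReD erefl).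
apply: eq_bigr => J _; rewrite big_split/= -rmorph_prod -mulrA rC mulrC; congr (_ * _).
by rewrite cis_sum -cisD -mulr_suml -natr_sum.
Qed.

End trig_product.

(** The product is at most the [n]-th power of the largest factor. *)
Lemma prod_le_sum_expn (R : realType) n (a : 'I_n -> R) :
  (0 < n)%N -> (forall i, 0 <= a i) -> \prod_i a i <= \sum_i a i ^+ n.
Proof.
move=> n0 a0; pose i0 := Ordinal n0.
pose m := [arg max_(i > i0) a i]%O.
have am i : a i <= a m.
  by rewrite /m; case: Order.TotalTheory.arg_maxP => // j _ /(_ i isT).
apply: (@le_trans _ _ (\prod_(i < n) a m)).
  by apply: ler_prod => i _; rewrite a0 am.
rewrite prodr_const card_ord (bigD1 m)//= lerDl sumr_ge0// => i _.
exact: exprn_ge0.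
Qed.

Section GG_product.
Context (R : realType) d (T : measurableType d) (P : probability T R).
Context (I : finType) (xis : I -> {RV P >-> R}) (al be ga : R).
Hypotheses (al0 : 0 < al) (be0 : 0 < be).
Hypothesis hxi : forall i, is_GG al be ga (xis i).
Hypothesis indep : mutually_independent xis.

(** The identity [prod_cos_sum_expand] is used twice: to separate the variables
    under the expectation, and then backwards, at the constant angles given by
    [GG_trig]. *)
Lemma GG_prod_trig (psi r : R) : 0 <= psi < pi / 2 -> 0 < ga + r ->
  exists2 C : R, 0 < C & forall (f : R -> R) (phi : R), measurable_fun setT f ->
    (forall x, 0 < x -> f x = x `^ r) ->
    \int[P]_t ((\prod_i f (xis i t)) *
        cos (\sum_i al * tan psi * xis i t `^ be + phi)) =
      C * cos (#|I|%:R * ((ga + r) / be * psi) + phi).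
Proof.
move=> psi01 gr.
have /choice[C hC] : forall i, exists C : R, 0 < C /\
   forall (f : R -> R) (phi : R), measurable_fun setT f ->
    (forall x, 0 < x -> f x = x `^ r) ->
    P.-integrable setT
      (fun t => (f (xis i t) * cos (al * tan psi * xis i t `^ be + phi))%:E) /\
    \int[P]_t (f (xis i t) * cos (al * tan psi * xis i t `^ be + phi)) =
      C * cos ((ga + r) / be * psi + phi).
  by move=> i; have [C C0 h] := GG_trig al0 be0 (hxi i) psi01 gr; exists C.
exists (\prod_i C i); first by apply: prodr_gt0 => i _; exact: (hC i).1.
move=> f phi mf fr; set Psi := (ga + r) / be * psi.
pose th x := al * tan psi * x `^ be.
pose h (b : bool) (x : R) := f x * (if b then sin (th x) else cos (th x)).
have mh b : measurable_fun setT (h b).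
  have mth : measurable_fun setT th.
    by apply: measurable_funM => //; exact: measurable_powR.
  apply: measurable_funM => //; case: b; last exact: measurable_cosT.
  apply: (measurableT_comp _ mth); apply: continuous_measurable_fun.
  exact: continuous_sin.
have hE i b : P.-integrable setT (fun t => (h b (xis i t))%:E) /\
    \int[P]_t h b (xis i t) = C i * (if b then sin Psi else cos Psi).
  case: b.
    have [i1 i2] := (hC i).2 f (- (pi / 2)) mf fr.
    have E t : h true (xis i t) = f (xis i t) * cos (th (xis i t) - pi / 2).
      by rewrite /h cosBpihalf.
    split; first by under eq_fun do rewrite E.
    by under eq_Rintegral do rewrite E; rewrite i2 -/Psi cosBpihalf.
  have [i1 i2] := (hC i).2 f 0 mf fr.
  have E t : h false (xis i t) = f (xis i t) * cos (th (xis i t) + 0).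
    by rewrite /h addr0.
  split; first by under eq_fun do rewrite E.
  by under eq_Rintegral do rewrite E; rewrite i2 -/Psi addr0.
under eq_Rintegral do rewrite prod_cos_sum_expand.
pose c (J : {ffun I -> bool}) := cos ((\sum_i J i)%:R * (pi / 2) + phi) : R.
have HJ (J : {ffun I -> bool}) :=
  independent_Rintegral_prod indep (fun i => mh (J i)) (fun i => (hE i (J i)).1).
transitivity (\sum_(J : {ffun I -> bool}) c J * \int[P]_t (\prod_i h (J i) (xis i t))).
  rewrite /Rintegral; under eq_integral do rewrite -sumEFin.
  have iJ J : P.-integrable setT (fun t => (c J * \prod_i h (J i) (xis i t))%:E).
    exact: (integrableZl measurableT (c J) (HJ J).1).
  rewrite integral_sum//.
  rewrite -sum_fine//; last by move=> J _; exact: (integrable_fin_num measurableT (iJ J)).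
  by apply: eq_bigr => J _; rewrite -[RHS]RintegralZl//; exact: (HJ J).1.
have -> : #|I|%:R * Psi = \sum_(i : I) Psi.
  by rewrite (eq_bigl (mem I)) ?sumr_const ?mulr_natl.
rewrite prod_cos_sum_expand; apply: eq_bigr => J _; congr (_ * _).
by rewrite (HJ J).2; apply: eq_bigr => i _; rewrite (hE i (J i)).2.
Qed.

End GG_product.

(** * Moment determinacy of powers and products *)

Lemma cosN_pihalf_pi_nat (R : realType) (j : nat) : cos (pi * j%:R - pi / 2) = 0 :> R.
Proof.
rewrite cosBpihalf; elim: j => [|j IH]; first by rewrite mulr0 sin0.
by rewrite -natr1 mulrDr mulr1 sinDpi IH oppr0.
Qed.

(** The function [cos (stat + phase)] is orthogonal to the powers of [U], as
    [cos (pi * j - pi / 2) = 0], but not to its square root.  The hypothesis is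
    made for multiplicative [f], so that [f U] splits when [U] is a product. *)
Lemma rotated_not_M_det (R : realType) d (T : measurableType d)
    (P : probability T R) (U : {RV P >-> R}) (stat : T -> R) (phase : R) :
  measurable_fun setT stat -> stieltjes_admissible U ->
  (forall (f : R -> R) (r : R), 0 <= r -> measurable_fun setT f ->
     (forall x y, f (x * y) = f x * f y) ->
     (forall x, 0 < x -> f x = x `^ r) ->
     exists2 c : R, 0 < c &
     \int[P]_t (f (U t) * cos (stat t + phase)) = c * cos (pi * r - pi / 2)) ->
  ~ M_det U.
Proof.
move=> mstat aU H.
apply: (@not_M_det _ _ _ P U (fun t => cos (stat t + phase))) => //.
- by apply: measurable_cosT; exact: measurable_funD.
- by move=> t; exact: cos_max.
- move=> j; have [||||c _ ->] := H (fun x => x ^+ j) j%:R => //.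
  + by move=> x y; rewrite exprMn.
  + by move=> x x0; rewrite powR_mulrn// ltW.
  + by rewrite cosN_pihalf_pi_nat mulr0.
- have [||||c c0 ->] := H (fun x => Num.sqrt `|x|) 2^-1.
  + by rewrite invr_ge0.
  + apply: measurableT_comp => //; apply: continuous_measurable_fun.
    exact: sqrt_continuous.
  + by move=> x y; rewrite normrM sqrtrM.
  + by move=> x x0; rewrite gtr0_norm// powR12_sqrt// ltW.
  + by rewrite subrr cos0 mulr1 gt_eqF.
Qed.

Theorem theorem6 (R : realType) (alpha beta gamma : R) (n : nat)
    (d d' : measure_display) (T : measurableType d) (T' : measurableType d')
    (P : probability T R) (P' : probability T' R)
    (xi : {RV P >-> R}) (xis : 'I_n -> {RV P' >-> R})
    (X : {RV P >-> R}) (Y : {RV P' >-> R}) :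
  0 < alpha -> 0 < beta -> 0 < gamma -> (2 <= n)%N ->
  is_GG alpha beta gamma xi ->
  (forall i, is_GG alpha beta gamma (xis i)) ->
  mutually_independent xis ->
  (forall t, X t = xi t ^+ n) ->
  (forall t, Y t = \prod_(i < n) xis i t) ->
  [/\ stieltjes_admissible X, stieltjes_admissible Y,
      M_det X <-> M_det Y & M_det X <-> n%:R <= 2 * beta].
Proof.
move=> al0 be0 ga0 n2 hxi hxis indep XE YE.
have n0 : (0 < n)%N by exact: ltn_trans n2.
have nR : 0 < (n%:R : R) by rewrite ltr0n.
have mpow j : measurable_fun setT (fun x : R => x ^+ j).
  exact: (measurable_funX j (@measurable_id _ _ setT)).
have mnpow j : measurable_fun setT (fun x : R => `|x| ^+ j).
  by apply: measurable_funX; exact: normr_measurable.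
have powE j (x : R) : 0 < x -> x ^+ j = x `^ j%:R.
  by move=> x0; rewrite powR_mulrn// ltW.
have npowE j (x : R) : 0 < x -> `|x| ^+ j = x `^ j%:R.
  by move=> x0; rewrite gtr0_norm// powE.
have gaj (j : nat) : 0 < gamma + j%:R by rewrite ltr_wpDr.
have iX j : P.-integrable setT (fun t => (X t ^+ j)%:E).
  under eq_fun do rewrite XE -exprM.
  exact: (GG_integrable_power al0 be0 hxi (gaj (n * j)%N) (mpow _) (@powE _)).
have inxi j i : P'.-integrable setT (fun t => (`|xis i t| ^+ j)%:E).
  exact: (GG_integrable_power al0 be0 (hxis i) (gaj j) (mnpow _) (@npowE _)).
have iY j : P'.-integrable setT (fun t => (Y t ^+ j)%:E).
  under eq_fun do rewrite YE -prodrXl.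
  apply: (independent_Rintegral_prod indep (fun=> mpow j) _).1 => i.
  exact: (GG_integrable_power al0 be0 (hxis i) (gaj j) (mpow _) (@powE _)).
have aX : stieltjes_admissible X.
  split; last exact: finite_moments_distribution.
  apply: supported_nonneg_distribution.
  by apply: filterS (GG_ae_ge0 hxi) => t; rewrite XE; exact: exprn_ge0.
have aY : stieltjes_admissible Y.
  split; last exact: finite_moments_distribution.
  apply: supported_nonneg_distribution.
  have : {ae P', forall t, forall i, 0 <= xis i t}.
    by apply: filter_forall => i; exact: (GG_ae_ge0 (hxis i)).
  by apply: filterS => t h; rewrite YE; exact: prodr_ge0.
have detX : n%:R <= 2 * beta -> M_det X.
  move=> /(GG_moment_le al0 be0 ga0 hxi)[C [b [C0 b0 h]]].
  apply: (hardy_M_det aX C0 b0 iX) => j; apply: le_trans (h j).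
  apply: le_Rintegral => //.
    exact: iX.
    exact: (GG_integrable_power al0 be0 hxi (gaj (n * j)%N) (mnpow _) (@npowE _)).
  by move=> t _; rewrite XE -exprM -normrX ler_norm.
have detY : n%:R <= 2 * beta -> M_det Y.
  move=> nbe.
  have /choice[C /choice[b h]] : forall i, exists C b : R, [/\ 0 <= C, 0 < b &
      forall j, \int[P']_t (`|xis i t| ^+ (n * j)) <= C * b ^+ (2 * j) * (2 * j)`!%:R].
    by move=> i; exact: (GG_moment_le al0 be0 ga0 (hxis i) nbe).
  (* The copies have the same law, but a common bound is obtained more simply by
     summing the constants than by comparing the laws. *)
  pose B := \sum_i b i.
  have bB i : 0 <= b i <= B.
    have [_ /ltW bi _] := h i; rewrite bi /B (bigD1 i)//= lerDl sumr_ge0// => k _.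
    by have [_ /ltW] := h k.
  apply: (@hardy_M_det _ _ _ _ _ (\sum_i C i) (B + 1) aY _ _ iY).
  - by apply: sumr_ge0 => i _; have [] := h i.
  - by have /andP[b1 b2] := bB (Ordinal n0); lra.
  move=> j; apply: (@le_trans _ _ (\int[P']_t (\sum_i `|xis i t| ^+ (n * j)))).
    apply: le_Rintegral => //.
      exact: iY.
      under [X in integrable _ _ X]eq_fun do rewrite /= -sumEFin.
      by apply: integrable_sum => // i _; exact: inxi.
    move=> t _; apply: (le_trans (ler_norm _)).
    rewrite YE normrX normr_prod -prodrXl.
    under [leRHS]eq_bigr do rewrite mulnC exprM.
    by apply: prod_le_sum_expn => // i; rewrite exprn_ge0.
  rewrite /Rintegral; under eq_integral do rewrite -sumEFin.
  rewrite integral_sum//.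
  rewrite -sum_fine//; last first.
    by move=> i _; exact: (integrable_fin_num measurableT (inxi _ i)).
  rewrite mulr_suml mulr_suml; apply: ler_sum => i _.
  have [Ci0 bi0 /(_ j) le1] := h i; apply: (le_trans le1).
  rewrite ler_wpM2r// ler_wpM2l// lerXn2r ?nnegrE ?ltW//.
    by have /andP[b1 b2] := bB i; lra.
  by have /andP[b1 b2] := bB i; lra.
(* The angle for which [psi / beta = pi / n]; it is less than [pi / 2] exactly
   when [2 * beta < n]. *)
pose psi := pi * beta / n%:R.
have psiE : psi / beta = pi / n%:R.
  by rewrite /psi; field; rewrite !gt_eqF.
have psi01 : 2 * beta < n%:R -> 0 <= psi < pi / 2.
  move=> nbe; rewrite divr_ge0 ?mulr_ge0 ?pi_ge0 ?(ltW be0)//=.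
  rewrite ltr_pdivrMr// mulrAC -mulrA ltr_pM2l ?pi_gt0//; lra.
have mphase : measurable_fun setT (fun x : R => alpha * tan psi * x `^ beta).
  by apply: measurable_funM => //; exact: measurable_powR.
have indetX : 2 * beta < n%:R -> ~ M_det X.
  move=> /psi01 hpsi; pose phase := - (pi * gamma / n%:R) - pi / 2.
  apply: (@rotated_not_M_det _ _ _ _ _
    (fun t => alpha * tan psi * xi t `^ beta) phase _ aX).
    exact: (measurableT_comp mphase).
  move=> f r r0 mf fM fr.
  have gr : 0 < gamma + n%:R * r by rewrite ltr_wpDr// mulr_ge0.
  have [C C0 hC] := GG_trig al0 be0 hxi hpsi gr.
  exists C => //; under eq_Rintegral do rewrite XE.
  have [||_ ->] := hC (fun x => f (x ^+ n)) phase.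
  - by apply: measurableT_comp => //; exact: mpow.
  - by move=> x x0; rewrite fr ?exprn_gt0// powE// powRrM.
  congr (_ * cos _); rewrite /phase mulrAC -mulrA psiE; field.
  by rewrite gt_eqF.
have indetY : 2 * beta < n%:R -> ~ M_det Y.
  move=> /psi01 hpsi; pose phase := - (pi * gamma) - pi / 2.
  apply: (@rotated_not_M_det _ _ _ _ _
    (fun t => \sum_i alpha * tan psi * xis i t `^ beta) phase _ aY).
    by apply: measurable_sum => i; exact: (measurableT_comp mphase).
  move=> f r r0 mf fM fr.
  have gr : 0 < gamma + r by rewrite ltr_wpDr.
  have [C C0 hC] := GG_prod_trig al0 be0 hxis indep hpsi gr.
  exists C => //; under eq_Rintegral do rewrite YE.
  have f1 : f 1 = 1 by rewrite fr// powR1.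
  under eq_Rintegral do rewrite (big_morph f fM f1).
  rewrite hC//; congr (_ * cos _).
  rewrite card_ord /phase -[_ / beta * psi]mulrA [beta^-1 * psi]mulrC psiE; field.
  by rewrite gt_eqF.
have XP : M_det X <-> n%:R <= 2 * beta.
  split=> [mX|]; last exact: detX.
  by rewrite leNgt; apply/negP => /indetX; exact.
have YP : M_det Y <-> n%:R <= 2 * beta.
  split=> [mY|]; last exact: detY.
  by rewrite leNgt; apply/negP => /indetY; exact.
by split => //; rewrite XP YP.
Qed.
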